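(* Let $\mathscr M\subset ba(\mathcal A)$. Conditions (i) and (ii) are equivalent and imply (iii): (i) $\mathscr M$ is relatively weakly compact; (ii) $\mathscr M$ is norm bounded and has the uniform Cauchy property: if $\mathscr M_0\subset\mathscr M$ and $(f_n)$ is a sequence in $\mathcal S(\mathcal A)$ with $\sup_n\|f_n\|_\infty<\infty$ which is Cauchy in $L^1(\mu)$ for every $\mu\in\mathscr M_0$, then $\lim_n\sup_{\mu\in\mathscr M_0}\sup_{p,q}|\mu|(|f_{n+p}-f_{n+q}|)=0$; (iii) $\mathscr M$ is norm bounded and for each uniformly bounded sequence $(f_n)$ in $\mathcal S(\mathcal A)$ which is Cauchy in $L^1(\mu)$ for every $\mu\in\mathscr M$, and each sequence $(\mu_k)$ in $\mathscr M$, $\operatorname{LIM}_k\lim_n\mu_k(f_n)=\lim_n\operatorname{LIM}_k\mu_k(f_n)$.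
   Context: $\mathcal A$ algebra of subsets of $\Omega$; $ba(\mathcal A)$ the Banach space of bounded finitely additive real set functions, norm $\|\mu\|=|\mu|(\Omega)$. $\mathcal S(\mathcal A)$ is the space of $\mathcal A$-simple functions with the sup norm $\|\cdot\|_\infty$; $\mu(f)=\int f\,d\mu$. A sequence of simple functions $(f_n)$ is Cauchy in $L^1(\mu)$ if $\lim_n\sup_{p,q}|\mu|(|f_{n+p}-f_{n+q}|)=0$. $\operatorname{LIM}_k$ denotes a (fixed) Banach limit on bounded real sequences. *)

(* Defs.v *)
From Stdlib Require Import Reals Lra List Classical ClassicalEpsilon.
Import ListNotations.
Open Scope R_scope.

Section Defs.
Context {Omega : Type}.

Definition setT : Omega -> Prop := fun _ => True.
Definition set0 : Omega -> Prop := fun _ => False.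

Definition is_algebra (A : (Omega -> Prop) -> Prop) : Prop :=
  A setT /\
  (forall E, A E -> A (fun x => ~ E x)) /\
  (forall E F, A E -> A F -> A (fun x => E x \/ F x)).

(** Supremum of a set of reals (meaningful when the set is nonempty and bounded). *)
Definition Rsup (S : R -> Prop) : R :=
  epsilon (inhabits 0) (fun s => is_lub S s).

Definition partition (A : (Omega -> Prop) -> Prop) (E : Omega -> Prop)
  (l : list (Omega -> Prop)) : Prop :=
  Forall A l /\
  (forall i j, (i < j)%nat -> (j < length l)%nat ->
     forall x, ~ (nth i l set0 x /\ nth j l set0 x)) /\
  (forall x, E x <-> Exists (fun F => F x) l).

Definition sum_abs (mu : (Omega -> Prop) -> R) (l : list (Omega -> Prop)) : R :=
  fold_right (fun F acc => Rabs (mu F) + acc) 0 l.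

Definition tv (A : (Omega -> Prop) -> Prop) (mu : (Omega -> Prop) -> R)
  (E : Omega -> Prop) : R :=
  Rsup (fun s => exists l, partition A E l /\ s = sum_abs mu l).

Definition fin_additive (A : (Omega -> Prop) -> Prop) (mu : (Omega -> Prop) -> R) : Prop :=
  forall E F, A E -> A F -> (forall x, ~ (E x /\ F x)) ->
    mu (fun x => E x \/ F x) = mu E + mu F.

(** mu belongs to ba(A): bounded finitely additive (values off A are irrelevant). *)
Definition in_ba (A : (Omega -> Prop) -> Prop) (mu : (Omega -> Prop) -> R) : Prop :=
  fin_additive A mu /\
  exists C, forall l, partition A setT l -> sum_abs mu l <= C.

Definition ba_norm (A : (Omega -> Prop) -> Prop) (mu : (Omega -> Prop) -> R) : R :=
  tv A mu setT.

Definition is_simple (A : (Omega -> Prop) -> Prop) (f : Omega -> R) : Prop :=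
  (exists l : list R, forall x, In (f x) l) /\ (forall v, A (fun x => f x = v)).

(** A duplicate-free list covering the range of f (when it exists). *)
Definition range_list (f : Omega -> R) : list R :=
  epsilon (inhabits nil) (fun l => NoDup l /\ forall x, In (f x) l).

Definition integ (mu : (Omega -> Prop) -> R) (f : Omega -> R) : R :=
  fold_right (fun v acc => v * mu (fun x => f x = v) + acc) 0 (range_list f).

Definition abs_integ (A : (Omega -> Prop) -> Prop) (mu : (Omega -> Prop) -> R)
  (g : Omega -> R) : R :=
  integ (tv A mu) (fun x => Rabs (g x)).

Definition L1_cauchy (A : (Omega -> Prop) -> Prop) (mu : (Omega -> Prop) -> R)
  (f : nat -> Omega -> R) : Prop :=
  forall eps, eps > 0 -> exists N, forall n, (N <= n)%nat -> forall p q,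
    abs_integ A mu (fun x => f (n + p)%nat x - f (n + q)%nat x) <= eps.

Definition unif_bounded (f : nat -> Omega -> R) : Prop :=
  exists C, forall n x, Rabs (f n x) <= C.

Definition norm_bounded (A : (Omega -> Prop) -> Prop)
  (M : ((Omega -> Prop) -> R) -> Prop) : Prop :=
  exists C, forall mu, M mu -> ba_norm A mu <= C.

Definition ba_dual (A : (Omega -> Prop) -> Prop)
  (phi : ((Omega -> Prop) -> R) -> R) : Prop :=
  (forall a b nu nu', in_ba A nu -> in_ba A nu' ->
     phi (fun E => a * nu E + b * nu' E) = a * phi nu + b * phi nu') /\
  (exists K, forall nu, in_ba A nu -> Rabs (phi nu) <= K * ba_norm A nu).

Definition weakly_open (A : (Omega -> Prop) -> Prop)
  (U : ((Omega -> Prop) -> R) -> Prop) : Prop :=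
  forall mu, in_ba A mu -> U mu ->
    exists (phis : list (((Omega -> Prop) -> R) -> R)) (eps : R),
      eps > 0 /\ Forall (ba_dual A) phis /\
      forall nu, in_ba A nu ->
        Forall (fun phi => Rabs (phi nu - phi mu) < eps) phis -> U nu.

Definition weak_closure (A : (Omega -> Prop) -> Prop)
  (M : ((Omega -> Prop) -> R) -> Prop) : ((Omega -> Prop) -> R) -> Prop :=
  fun mu => in_ba A mu /\
    forall U, weakly_open A U -> U mu -> exists nu, M nu /\ U nu.

Definition weakly_compact (A : (Omega -> Prop) -> Prop)
  (K : ((Omega -> Prop) -> R) -> Prop) : Prop :=
  forall (I : Type) (U : I -> ((Omega -> Prop) -> R) -> Prop),
    (forall i, weakly_open A (U i)) ->
    (forall mu, K mu -> exists i, U i mu) ->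
    exists l : list I, forall mu, K mu -> exists i, In i l /\ U i mu.

Definition rel_weakly_compact (A : (Omega -> Prop) -> Prop)
  (M : ((Omega -> Prop) -> R) -> Prop) : Prop :=
  weakly_compact A (weak_closure A M).

Definition uniform_cauchy (A : (Omega -> Prop) -> Prop)
  (M : ((Omega -> Prop) -> R) -> Prop) : Prop :=
  forall (M0 : ((Omega -> Prop) -> R) -> Prop) (f : nat -> Omega -> R),
    (forall mu, M0 mu -> M mu) ->
    (forall n, is_simple A (f n)) ->
    unif_bounded f ->
    (forall mu, M0 mu -> L1_cauchy A mu f) ->
    forall eps, eps > 0 -> exists N, forall n, (N <= n)%nat ->
      forall mu, M0 mu -> forall p q,
        abs_integ A mu (fun x => f (n + p)%nat x - f (n + q)%nat x) <= eps.

End Defs.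

Definition bounded_seq (x : nat -> R) : Prop := exists C, forall n, Rabs (x n) <= C.

Definition banach_limit (L : (nat -> R) -> R) : Prop :=
  (forall a b x y, bounded_seq x -> bounded_seq y ->
     L (fun n => a * x n + b * y n) = a * L x + b * L y) /\
  (forall x, bounded_seq x -> (forall n, 0 <= x n) -> 0 <= L x) /\
  (forall x, bounded_seq x -> L (fun n => x (S n)) = L x) /\
  L (fun _ => 1) = 1.

(* Main.v *)
(** (i) -> (ii). If the uniform Cauchy property fails, one extracts measures [mu_k] in [M] and sets
    [H_k] with [|mu_k|(H_k)] bounded below and [|mu_i|(H_j)] summably small for [i < j]. The set
    functions obtained by removing the later [H_j] from (parts of) [H_k] give a bounded linear map
    from ba to l^1 whose diagonal on [(mu_k)] does not vanish, against relative weak compactness.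

    (ii) -> (i). Applied to indicator functions, the uniform Cauchy property makes [M] uniformly
    absolutely continuous, for each [eps], with respect to some finite sum [lam] of variations
    [|mu|]. Measures dominated by [lam] have approximate densities, so every functional in ba* is,
    uniformly on [M], close to integration of a simple function. Hence on the weak closure of [M]
    setwise convergence along an ultrafilter is weak convergence, and setwise limits exist.

    (ii) -> (iii) is an interchange of limits that are uniform in [k]. *)
From Stdlib Require Import Reals List Lra Lia Classical ClassicalEpsilon.
From Stdlib Require Import FunctionalExtensionality PropExtensionality.
From mathcomp Require filter.
Require Import Defs.
Import ListNotations.
Open Scope R_scope.

(** Only an algebra of sets and finite additivity are available: countable unions may leave the
    algebra, sequences of sets have no limits in it, and L^1 over simple functions is not complete.
    Infinite constructions are therefore moved into the dual, as pointwise Banach limits of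
    functionals built from evaluations at sets. The [L] of (iii) thus also produces the test
    functionals that prove (i) -> (ii).

    That the diagonal must vanish is Schur's theorem in disguise: relatively weakly compact subsets
    of l^1 have uniformly small tails. Its gliding hump is run directly on weak cluster points of
    sequences, without extracting weakly convergent subsequences. Norm boundedness of M is obtained
    from a gliding hump as well.

    In the other direction, an ultrafilter limit is not known to lie in the weak closure until weak
    convergence is proved, and the estimates giving weak convergence must already apply to it. They
    are therefore established on a larger set of measures. *)

Lemma Rabs_le_inv a b : Rabs a <= b -> - b <= a <= b.
Proof.
  intros H. assert (H1 := Rle_abs a). assert (H2 := Rle_abs (- a)). rewrite Rabs_Ropp in H2. lra.
Qed.

(** * Finite sums, choice and ultrafilters *)

Definition lsum {T : Type} (f : T -> R) (l : list T) : R :=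
  fold_right (fun v acc => f v + acc) 0 l.

Lemma lsum_ext_in {T} (f g : T -> R) l :
  (forall v, In v l -> f v = g v) -> lsum f l = lsum g l.
Proof.
  induction l as [|a l IH]; intros H; simpl; auto.
  rewrite (H a), IH; auto; [intros; apply H|]; simpl; auto.
Qed.

Lemma lsum_le_in {T} (f g : T -> R) l :
  (forall v, In v l -> f v <= g v) -> lsum f l <= lsum g l.
Proof.
  induction l as [|a l IH]; intros H; simpl; [lra|].
  assert (f a <= g a) by (apply H; simpl; auto).
  assert (lsum f l <= lsum g l) by (apply IH; intros; apply H; simpl; auto).
  lra.
Qed.

Lemma lsum_lin {T} (a b : R) (f g : T -> R) l :
  lsum (fun v => a * f v + b * g v) l = a * lsum f l + b * lsum g l.
Proof. induction l as [|c l IH]; simpl; [ring|rewrite IH; ring]. Qed.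

Lemma lsum_plus {T} (f g : T -> R) l :
  lsum (fun v => f v + g v) l = lsum f l + lsum g l.
Proof. induction l as [|c l IH]; simpl; [ring|rewrite IH; ring]. Qed.

Lemma lsum_scal {T} (a : R) (f : T -> R) l :
  lsum (fun v => a * f v) l = a * lsum f l.
Proof. induction l as [|c l IH]; simpl; [ring|rewrite IH; ring]. Qed.

Lemma lsum_zero {T} (l : list T) : lsum (fun _ => 0) l = 0.
Proof. induction l as [|c l IH]; simpl; [ring|rewrite IH; ring]. Qed.

Lemma lsum_ge0 {T} (f : T -> R) l : (forall v, In v l -> 0 <= f v) -> 0 <= lsum f l.
Proof. intros H; rewrite <- (lsum_zero l); apply lsum_le_in; auto. Qed.

Lemma lsum_app {T} (f : T -> R) l l' : lsum f (l ++ l') = lsum f l + lsum f l'.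
Proof. induction l as [|c l IH]; simpl; [ring|rewrite IH; ring]. Qed.

Lemma lsum_map {S T} (h : S -> T) (f : T -> R) l :
  lsum f (map h l) = lsum (fun v => f (h v)) l.
Proof. induction l as [|c l IH]; simpl; [ring|rewrite IH; ring]. Qed.

Lemma lsum_abs {T} (f : T -> R) l : Rabs (lsum f l) <= lsum (fun v => Rabs (f v)) l.
Proof.
  induction l as [|c l IH]; simpl; [rewrite Rabs_R0; lra|].
  eapply Rle_trans; [apply Rabs_triang|lra].
Qed.

Lemma lsum_swap {S T} (f : S -> T -> R) l l' :
  lsum (fun v => lsum (f v) l') l = lsum (fun w => lsum (fun v => f v w) l) l'.
Proof.
  induction l as [|c l IH]; simpl.
  - now rewrite lsum_zero.
  - now rewrite IH, <- lsum_plus.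
Qed.

Lemma lsum_in_le {T} (f : T -> R) l a :
  (forall v, In v l -> 0 <= f v) -> In a l -> f a <= lsum f l.
Proof.
  induction l as [|c l IH]; simpl; intros H []; subst.
  - assert (0 <= lsum f l) by (apply lsum_ge0; auto). lra.
  - specialize (IH (fun v h => H v (or_intror h)) H0). specialize (H c (or_introl eq_refl)). lra.
Qed.

Lemma lsum_bound {T} (f : T -> R) l c :
  (forall v, In v l -> f v <= c) -> lsum f l <= INR (length l) * c.
Proof.
  induction l as [|a l IH]; intros H; [simpl; lra|].
  change (length (a :: l)) with (S (length l)). rewrite S_INR. simpl.
  assert (f a <= c) by (apply H; simpl; auto).
  assert (lsum f l <= INR (length l) * c) by (apply IH; intros; apply H; simpl; auto).
  lra.
Qed.

Lemma NoDup_cover {T} (P : T -> Prop) l : (forall v, P v -> In v l) ->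
  exists l', NoDup l' /\ forall v, P v -> In v l'.
Proof.
  intros H. exists (nodup (fun x y => excluded_middle_informative (x = y)) l).
  split; [apply NoDup_nodup|]. intros v Hv. apply nodup_In; auto.
Qed.

(** The step condition [P] sees all previous choices, as gliding humps require, and [length l] tells
    it the stage, so constants may depend on n. *)
Lemma dependent_choice_list {X : Type} (Q : X -> Prop) (P : list X -> X -> Prop) :
  (forall l, Forall Q l -> exists x, Q x /\ P l x) ->
  exists u : nat -> X, forall n, Q (u n) /\ P (map u (seq 0 n)) (u n).
Proof.
  intros H.
  destruct (H nil (Forall_nil _)) as [x0 _].
  pose (nxt := fun l => epsilon (inhabits x0) (fun x => Q x /\ P l x)).
  pose (ls := fix ls n := match n with O => nil | S k => ls k ++ [nxt (ls k)] end).
  assert (Hn : forall l, Forall Q l -> Q (nxt l) /\ P l (nxt l)).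
  { intros l Hl. unfold nxt. apply epsilon_spec. now apply H. }
  assert (Hls : forall n, Forall Q (ls n)).
  { induction n; simpl; [constructor|]. apply Forall_app; split; auto.
    constructor; [now apply Hn|constructor]. }
  exists (fun n => nxt (ls n)). intros n.
  assert (E : map (fun n => nxt (ls n)) (seq 0 n) = ls n).
  { induction n; [reflexivity|]. rewrite seq_S, map_app, IHn. reflexivity. }
  rewrite E. apply Hn, Hls.
Qed.

Lemma set_ext {T} (E F : T -> Prop) : (forall x, E x <-> F x) -> E = F.
Proof. intros H; extensionality x; apply propositional_extensionality; auto. Qed.

(** The ultrafilter lemma of mathcomp, restated with bare predicates so that its set and filter
    structures stay out of the rest. *)
Lemma ultrafilter_extends {T : Type} (F : (T -> Prop) -> Prop) :
  F (fun _ => True) -> (forall X Y, F X -> F Y -> F (fun x => X x /\ Y x)) ->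
  (forall X Y : T -> Prop, (forall x, X x -> Y x) -> F X -> F Y) -> ~ F (fun _ => False) ->
  exists G : (T -> Prop) -> Prop,
    (forall X Y, G X -> G Y -> G (fun x => X x /\ Y x)) /\
    (forall X Y : T -> Prop, (forall x, X x -> Y x) -> G X -> G Y) /\
    ~ G (fun _ => False) /\ (forall X, G X \/ G (fun x => ~ X x)) /\ (forall X, F X -> G X).
Proof.
  intros FT FI FS F0.
  assert (HF : @filter.ProperFilter T F) by (split; [exact F0|split; [exact FT|exact FI|exact FS]]).
  destruct (filter.ultraFilterLemma HF) as [G [GU GF]].
  assert (GU' := GU). destruct GU' as [[G0 [GT GI GS]] _].
  exists G. split; [exact GI|]. split; [exact GS|]. split; [exact G0|]. split; [|exact GF].
  intros X. exact (filter.in_ultra_setVsetC X GU).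
Qed.

(** The limit is the supremum of the levels r for which [G] contains {r <= f}. *)
Lemma ultrafilter_limit {T : Type} (G : (T -> Prop) -> Prop) :
  (forall X Y, G X -> G Y -> G (fun x => X x /\ Y x)) ->
  (forall X Y : T -> Prop, (forall x, X x -> Y x) -> G X -> G Y) ->
  ~ G (fun _ => False) -> (forall X, G X \/ G (fun x => ~ X x)) ->
  forall (f : T -> R) C, G (fun x => Rabs (f x) <= C) ->
  exists r, forall e, 0 < e -> G (fun x => Rabs (f x - r) <= e).
Proof.
  intros GI GS G0 GU f C HC.
  destruct (completeness (fun r => G (fun x => r <= f x))) as [r [Hr1 Hr2]].
  - exists C. intros r Hr. apply Rnot_lt_le. intros Hlt. apply G0.
    eapply GS; [|exact (GI _ _ Hr HC)]. intros x [H1 H2]. apply Rabs_le_inv in H2. lra.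
  - exists (- C). eapply GS; [|exact HC]. intros x H. apply Rabs_le_inv in H. lra.
  - exists r. intros e He.
    assert (H1 : exists r', r - e < r' /\ G (fun x => r' <= f x)).
    { apply NNPP. intros Hn. assert (r <= r - e); [|lra]. apply Hr2. intros r' Hr'.
      apply Rnot_lt_le. intros Hlt. apply Hn; eauto. }
    destruct H1 as [r' [Hr' H1]].
    destruct (GU (fun x => r + e <= f x)) as [H2|H2].
    + assert (r + e <= r) by now apply Hr1. lra.
    + eapply GS; [|exact (GI _ _ H1 H2)]. intros x [H3 H4]. apply Rabs_le. lra.
Qed.

(** Disjointness in a form suited to induction on lists; [disjl_nth] links it to the indexed clause
    of [partition]. *)
Definition disjl {T} (l : list (T -> Prop)) : Prop :=
  ForallOrdPairs (fun E F => forall x, ~ (E x /\ F x)) l.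

Lemma disjl_nth {T} (l : list (T -> Prop)) :
  disjl l <-> (forall i j, (i < j)%nat -> (j < length l)%nat ->
     forall x, ~ (nth i l set0 x /\ nth j l set0 x)).
Proof.
  split.
  - intros H. induction H as [|E l HE Hl IH]; simpl; intros i j Hij Hj; [lia|].
    destruct j; [lia|]. destruct i.
    + rewrite Forall_forall in HE. apply HE. apply nth_In. lia.
    + apply IH; lia.
  - induction l as [|E l IH]; intros H; constructor.
    + apply Forall_forall. intros F HF. destruct (In_nth _ _ set0 HF) as [j [Hj <-]].
      apply (H 0%nat (S j)); simpl; lia.
    + apply IH. intros i j Hij Hj. apply (H (S i) (S j)); simpl; lia.
Qed.

Lemma disjl_map_NoDup {I T} (D : I -> T -> Prop) l :
  NoDup l -> (forall i j, In i l -> In j l -> i <> j -> forall x, ~ (D i x /\ D j x)) ->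
  disjl (map D l).
Proof.
  induction 1 as [|a l Ha Hl IH]; intros H; simpl; constructor.
  - apply Forall_forall. intros F HF. apply in_map_iff in HF. destruct HF as [j [<- Hj]].
    apply H; simpl; auto. intros <-; auto.
  - apply IH. intros; apply H; simpl; auto.
Qed.

Definition bigU {T} (l : list (T -> Prop)) : T -> Prop := fun x => Exists (fun F => F x) l.

Definition ind {T} (E : T -> Prop) (x : T) : R :=
  if excluded_middle_informative (E x) then 1 else 0.

(** * Integration of simple functions *)

Section Algebra.
Context {Omega : Type} (A : (Omega -> Prop) -> Prop) (hA : is_algebra A).
Implicit Types (E F G : Omega -> Prop) (mu nu : (Omega -> Prop) -> R).

Lemma alg_T : A setT. Proof. apply hA. Qed.

Lemma alg_C E : A E -> A (fun x => ~ E x). Proof. apply hA. Qed.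

Lemma alg_U E F : A E -> A F -> A (fun x => E x \/ F x). Proof. apply hA. Qed.

Lemma alg_0 : A (fun _ => False).
Proof.
  replace (fun _ : Omega => False) with (fun x : Omega => ~ setT x).
  - apply alg_C, alg_T.
  - apply set_ext; unfold setT; tauto.
Qed.

Lemma alg_I E F : A E -> A F -> A (fun x => E x /\ F x).
Proof.
  intros HE HF.
  replace (fun x => E x /\ F x) with (fun x => ~ (~ E x \/ ~ F x)).
  - apply alg_C, alg_U; now apply alg_C.
  - apply set_ext; intros x; tauto.
Qed.

Lemma alg_D E F : A E -> A F -> A (fun x => E x /\ ~ F x).
Proof. intros; apply alg_I; auto using alg_C. Qed.

Lemma alg_bigU l : Forall A l -> A (bigU l).
Proof.
  induction 1 as [|E l HE _ IH].
  - replace (@bigU Omega nil) with (fun _ : Omega => False); [apply alg_0|].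
    apply set_ext; intros x; unfold bigU; rewrite Exists_nil; tauto.
  - replace (bigU (E :: l)) with (fun x => E x \/ bigU l x); [now apply alg_U|].
    apply set_ext; intros x; unfold bigU; rewrite Exists_cons; tauto.
Qed.

Lemma bigU_cons E l : bigU (E :: l) = (fun x => E x \/ bigU l x).
Proof. apply set_ext; intros x; unfold bigU; rewrite Exists_cons; tauto. Qed.

Lemma bigU_In l x : bigU l x <-> exists F, In F l /\ F x.
Proof. unfold bigU. now rewrite Exists_exists. Qed.

(* Simple functions are the case [T = R]; joint labellings [x |-> (f x, g x)] serve as common refinements. *)
Definition labelling {T : Type} (p : Omega -> T) : Prop :=
  (exists l : list T, forall x, In (p x) l) /\ (forall v, A (fun x => p x = v)).

(** A preimage is a finite union of fibres over a list covering the range. *)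
Lemma labelling_pred {T} (p : Omega -> T) (Q : T -> Prop) :
  labelling p -> A (fun x => Q (p x)).
Proof.
  intros [[l Hl] Hp].
  enough (H : A (fun x => In (p x) l /\ Q (p x))).
  { erewrite set_ext; [exact H|]. intros x; split; [split; auto|tauto]. }
  clear Hl. induction l as [|a l IH].
  - erewrite set_ext; [exact alg_0|]. simpl; tauto.
  - destruct (classic (Q a)) as [Ha|Ha].
    + erewrite set_ext; [exact (alg_U _ _ (Hp a) IH)|].
      intros x; simpl; split.
      * intros [[<-|H1] H2]; auto.
      * intros [<-|H]; tauto.
    + erewrite set_ext; [exact IH|].
      intros x; simpl; split; [|tauto].
      intros [[<-|H1] H2]; tauto.
Qed.

Lemma labelling_comp {S T} (c : S -> T) (p : Omega -> S) :
  labelling p -> labelling (fun x => c (p x)).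
Proof.
  intros Hp; split.
  - destruct Hp as [[l Hl] _]. exists (map c l). intros x; now apply in_map.
  - intros v. now apply (labelling_pred p (fun w => c w = v)).
Qed.

Lemma labelling_pair {S T} (p : Omega -> S) (q : Omega -> T) :
  labelling p -> labelling q -> labelling (fun x => (p x, q x)).
Proof.
  intros [[l Hl] Hp] [[l' Hl'] Hq]; split.
  - exists (list_prod l l'). intros x; now apply in_prod.
  - intros [v w]. erewrite set_ext; [exact (alg_I _ _ (Hp v) (Hq w))|].
    intros x; split; [intros H; injection H; auto|intros [-> ->]; auto].
Qed.

(** Factoring through [bool] leaves two fibres to check instead of one for every real. *)
Lemma labelling_ind E : A E -> labelling (ind E).
Proof.
  intros HE. unfold ind.
  set (p := fun x => if excluded_middle_informative (E x) then true else false).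
  assert (Hp : labelling p).
  { split; [exists [true; false]; intros x; destruct (p x); simpl; auto|].
    intros [|]; unfold p.
    - erewrite set_ext; [exact HE|]. intros x; simpl.
      destruct excluded_middle_informative; split; auto; discriminate.
    - erewrite set_ext; [exact (alg_C _ HE)|]. intros x; simpl.
      destruct excluded_middle_informative; split; auto; try discriminate; tauto. }
  replace (fun x => if excluded_middle_informative (E x) then 1 else 0)
    with (fun x => (fun b : bool => if b then 1 else 0) (p x)).
  - exact (labelling_comp (fun b : bool => if b then 1 else 0) p Hp).
  - extensionality x. unfold p. now destruct excluded_middle_informative.
Qed.

Lemma simple_comp (c : R -> R) f : is_simple A f -> is_simple A (fun x => c (f x)).
Proof. exact (labelling_comp c f). Qed.

Lemma simple_comp2 (c : R -> R -> R) f g :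
  is_simple A f -> is_simple A g -> is_simple A (fun x => c (f x) (g x)).
Proof.
  intros Hf Hg.
  exact (labelling_comp (fun v => c (fst v) (snd v)) _ (labelling_pair f g Hf Hg)).
Qed.

Lemma simple_const (c : R) : is_simple A (fun _ => c).
Proof.
  split; [exists [c]; simpl; auto|]. intros v.
  destruct (classic (c = v)).
  - erewrite set_ext; [exact alg_T|]. unfold setT; tauto.
  - erewrite set_ext; [exact alg_0|]. tauto.
Qed.

(** The list may also contain values that are not attained; for additive mu their empty fibres
    contribute 0 to [integ]. *)
Lemma range_list_spec f : is_simple A f ->
  NoDup (range_list f) /\ forall x, In (f x) (range_list f).
Proof.
  intros [[l Hl] _]. unfold range_list. apply epsilon_spec.
  destruct (NoDup_cover (fun v => exists x, f x = v) l) as [l' [H1 H2]].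
  - intros v [x <-]; auto.
  - exists l'; split; auto. intros x; apply H2; eauto.
Qed.

Lemma add_empty mu E : fin_additive A mu -> (forall x, ~ E x) -> mu E = 0.
Proof.
  intros Hmu HE.
  assert (H : E = fun _ => False) by (apply set_ext; intros x; specialize (HE x); tauto).
  subst E. assert (H := Hmu _ _ alg_0 alg_0 ltac:(tauto)).
  cbv beta in H. replace (fun _ : Omega => False \/ False) with (fun _ : Omega => False) in H
    by (apply set_ext; tauto).
  lra.
Qed.

Lemma add_split mu E F : fin_additive A mu -> A E -> A F ->
  mu E = mu (fun x => E x /\ F x) + mu (fun x => E x /\ ~ F x).
Proof.
  intros Hmu HE HF. rewrite <- Hmu; auto using alg_I, alg_D; [|intros x; tauto].
  f_equal. apply set_ext; intros x; tauto.
Qed.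

Lemma add_labelling {T} mu (p : Omega -> T) E l :
  fin_additive A mu -> labelling p -> A E -> NoDup l ->
  mu (fun x => E x /\ In (p x) l) = lsum (fun w => mu (fun x => E x /\ p x = w)) l.
Proof.
  intros Hmu Hp HE. induction 1 as [|a l Ha Hl IH]; simpl.
  - apply add_empty; auto. tauto.
  - rewrite <- IH, <- Hmu.
    + f_equal. apply set_ext; intros x. split; [intros [? [|]]|intros [[]|[]]]; auto.
    + apply alg_I; auto. apply Hp.
    + apply alg_I; auto. exact (labelling_pred p (fun w => In w l) Hp).
    + intros x [[_ <-] [_ H]]; auto.
Qed.

(** Change of variables for a labelling [p] through which the function factors: both sides are sums
    over joint fibres. It frees [integ] from the particular [range_list] and lets several functions
    be integrated over one common list. *)
Lemma integ_comp {T} mu (p : Omega -> T) (c : T -> R) l :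
  fin_additive A mu -> labelling p -> NoDup l -> (forall x, In (p x) l) ->
  integ mu (fun x => c (p x)) = lsum (fun w => c w * mu (fun x => p x = w)) l.
Proof.
  intros Hmu Hp Hl Hc. set (f := fun x => c (p x)).
  assert (Hf : labelling f) by exact (labelling_comp c p Hp).
  destruct (range_list_spec f Hf) as [Hr Hr'].
  change (lsum (fun v => v * mu (fun x => f x = v)) (range_list f) =
    lsum (fun w => c w * mu (fun x => p x = w)) l).
  transitivity (lsum (fun v => lsum (fun w => c w * mu (fun x => f x = v /\ p x = w)) l)
    (range_list f)).
  - apply lsum_ext_in. intros v _.
    assert (EQ : (fun x => f x = v) = (fun x => f x = v /\ In (p x) l))
      by (apply set_ext; intros x; specialize (Hc x); tauto).
    rewrite EQ, (add_labelling mu p (fun x => f x = v)); auto; [|apply Hf].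
    rewrite <- lsum_scal. apply lsum_ext_in. intros w _.
    (* The joint fibre is empty unless v = [c w], so v may be replaced by [c w]. *)
    destruct (classic (c w = v)) as [->|Hne]; auto.
    rewrite (add_empty mu (fun x => f x = v /\ p x = w)); auto; [ring|].
    intros x [H1 H2]. apply Hne. now rewrite <- H1, <- H2.
  - rewrite lsum_swap. apply lsum_ext_in. intros w _.
    rewrite lsum_scal. f_equal.
    rewrite (lsum_ext_in _ (fun v => mu (fun x => p x = w /\ f x = v)))
      by (intros v _; f_equal; apply set_ext; tauto).
    rewrite <- (add_labelling mu f (fun x => p x = w)); auto; [|apply Hp].
    f_equal. apply set_ext; intros x.
    assert (Hx : In (f x) (range_list f)) by apply Hr'. tauto.
Qed.

Lemma labelling_cover {T} (p : Omega -> T) : labelling p ->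
  exists l, NoDup l /\ forall x, In (p x) l.
Proof.
  intros [[l Hl] _]. destruct (NoDup_cover (fun v => exists x, p x = v) l) as [l' [H1 H2]].
  - intros v [x <-]; auto.
  - exists l'; split; auto. intros x; apply H2; eauto.
Qed.

Lemma integ_lin mu f g a b : fin_additive A mu -> is_simple A f -> is_simple A g ->
  integ mu (fun x => a * f x + b * g x) = a * integ mu f + b * integ mu g.
Proof.
  intros Hmu Hf Hg. assert (Hp := labelling_pair f g Hf Hg).
  destruct (labelling_cover _ Hp) as [l [Hl Hc]].
  assert (E1 := integ_comp mu _ (fun v => a * fst v + b * snd v) l Hmu Hp Hl Hc).
  assert (E2 := integ_comp mu _ fst l Hmu Hp Hl Hc).
  assert (E3 := integ_comp mu _ snd l Hmu Hp Hl Hc).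
  cbn [fst snd] in *. change (fun x => f x) with f in E2. change (fun x => g x) with g in E3.
  rewrite E1, E2, E3, <- lsum_lin. apply lsum_ext_in; intros; ring.
Qed.

Definition pos_add (m : (Omega -> Prop) -> R) : Prop :=
  fin_additive A m /\ forall E, A E -> 0 <= m E.

Lemma integ_le m f g : pos_add m -> is_simple A f -> is_simple A g ->
  (forall x, f x <= g x) -> integ m f <= integ m g.
Proof.
  intros [Hm Hm0] Hf Hg Hfg. assert (Hp := labelling_pair f g Hf Hg).
  destruct (labelling_cover _ Hp) as [l [Hl Hc]].
  assert (E2 := integ_comp m _ fst l Hm Hp Hl Hc).
  assert (E3 := integ_comp m _ snd l Hm Hp Hl Hc).
  cbn [fst snd] in *. change (fun x => f x) with f in E2. change (fun x => g x) with g in E3.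
  rewrite E2, E3. apply lsum_le_in. intros [v w] _; simpl.
  (* Listed pairs that are not attained may violate [v <= w], but carry no mass. *)
  destruct (classic (exists x, (f x, g x) = (v, w))) as [[x Hx]|Hne].
  - apply Rmult_le_compat_r; [apply Hm0, Hp|]. injection Hx as <- <-; auto.
  - rewrite (add_empty m); auto; [lra|]. intros x Hx; eauto.
Qed.

Lemma integ_abs mu m f : fin_additive A mu -> fin_additive A m ->
  (forall E, A E -> Rabs (mu E) <= m E) -> is_simple A f ->
  Rabs (integ mu f) <= integ m (fun x => Rabs (f x)).
Proof.
  intros Hmu Hm H Hf. destruct (range_list_spec f Hf) as [Hl Hc].
  rewrite (integ_comp m f Rabs _ Hm Hf Hl Hc).
  eapply Rle_trans; [exact (lsum_abs (fun v => v * mu (fun x => f x = v)) _)|].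
  apply lsum_le_in. intros v _. rewrite Rabs_mult.
  apply Rmult_le_compat_l; [apply Rabs_pos|]. apply H, Hf.
Qed.

Lemma integ_ind mu E : fin_additive A mu -> A E -> integ mu (ind E) = mu E.
Proof.
  intros Hmu HE. assert (Hi := labelling_ind E HE).
  assert (Hn : NoDup [1; 0]).
  { constructor; [simpl; intros [|[]]; lra|]. constructor; [simpl; tauto|constructor]. }
  assert (Hc : forall x, In (ind E x) [1; 0])
    by (intros x; unfold ind; destruct excluded_middle_informative; simpl; auto).
  transitivity (lsum (fun v => v * mu (fun x => ind E x = v)) [1; 0]);
    [exact (integ_comp mu (ind E) (fun v => v) _ Hmu Hi Hn Hc)|]. simpl.
  replace (fun x => ind E x = 1) with E; [ring|].
  apply set_ext; intros x. unfold ind. destruct excluded_middle_informative; split; auto; try lra; tauto.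
Qed.

Lemma integ_const mu c : fin_additive A mu -> integ mu (fun _ => c) = c * mu setT.
Proof.
  intros Hmu. assert (H := integ_lin mu (ind setT) (ind setT) c 0 Hmu
    (labelling_ind _ alg_T) (labelling_ind _ alg_T)).
  rewrite (integ_ind mu setT Hmu alg_T) in H. rewrite <- (Rplus_0_r (c * _)).
  rewrite <- (Rmult_0_l (mu setT)), <- H. f_equal. extensionality x.
  unfold ind. destruct excluded_middle_informative; [ring|]. exfalso; apply n; exact I.
Qed.

(** * Variation *)

Lemma partition_iff E l :
  partition A E l <-> Forall A l /\ disjl l /\ forall x, E x <-> bigU l x.
Proof. unfold partition, bigU. now rewrite (disjl_nth l). Qed.

Lemma add_bigU mu l : fin_additive A mu -> Forall A l -> disjl l ->
  mu (bigU l) = lsum mu l.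
Proof.
  intros Hmu Hl Hd. induction Hd as [|E l HE Hd IH].
  - simpl. apply add_empty; auto. intros x Hx. apply bigU_In in Hx. now destruct Hx as [F [[] _]].
  - inversion_clear Hl. rewrite bigU_cons, Hmu, IH; auto using alg_bigU.
    intros x [H1 H2]. apply bigU_In in H2. destruct H2 as [F [HF Fx]].
    rewrite Forall_forall in HE. exact (HE F HF x (conj H1 Fx)).
Qed.

Lemma partition_1 E : A E -> partition A E [E].
Proof.
  intros HE. apply partition_iff. split; [auto|split].
  - repeat constructor.
  - intros x. rewrite bigU_In. simpl. split; [eauto|intros [F [[<-|[]] H]]; auto].
Qed.

(** Adding the remainder turns a disjoint family inside E into a partition of E, so variation can be
    handled with families that need not exhaust E. *)
Lemma partition_extend E l : A E -> Forall A l -> disjl l -> (forall x, bigU l x -> E x) ->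
  partition A E ((fun x => E x /\ ~ bigU l x) :: l).
Proof.
  intros HE Hl Hd Hs. apply partition_iff. split; [|split].
  - constructor; auto. apply alg_D; auto. now apply alg_bigU.
  - constructor; auto. apply Forall_forall. intros F HF x [[_ H1] H2].
    apply H1, bigU_In; eauto.
  - intros x. rewrite bigU_cons. specialize (Hs x). tauto.
Qed.

(** [Rsup] is chosen by epsilon and means something only once the supremum exists. A partition of E,
    completed by the complement of E, obeys the bound given by [in_ba]. *)
Lemma tv_lub mu E : in_ba A mu -> A E ->
  is_lub (fun s => exists l, partition A E l /\ s = sum_abs mu l) (tv A mu E).
Proof.
  intros [Hmu [C HC]] HE. unfold tv, Rsup. apply epsilon_spec.
  destruct (completeness (fun s => exists l, partition A E l /\ s = sum_abs mu l)) as [s Hs].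
  - exists C. intros s [l [Hl ->]]. apply partition_iff in Hl. destruct Hl as [H1 [H2 H3]].
    specialize (HC _ (partition_extend setT l alg_T H1 H2 (fun _ _ => I))).
    simpl in HC. assert (H := Rabs_pos (mu (fun x => setT x /\ ~ bigU l x))). lra.
  - exists (sum_abs mu [E]). exists [E]. split; auto using partition_1.
  - now exists s.
Qed.

Lemma sum_abs_le_tv mu E l : in_ba A mu -> A E -> Forall A l -> disjl l ->
  (forall x, bigU l x -> E x) -> sum_abs mu l <= tv A mu E.
Proof.
  intros Hmu HE H1 H2 H3.
  assert (H := proj1 (tv_lub mu E Hmu HE) _
    (ex_intro _ _ (conj (partition_extend E l HE H1 H2 H3) eq_refl))).
  simpl in H. assert (H' := Rabs_pos (mu (fun x => E x /\ ~ bigU l x))). lra.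
Qed.

Lemma tv_le mu E c : in_ba A mu -> A E ->
  (forall l, Forall A l -> disjl l -> (forall x, bigU l x -> E x) -> sum_abs mu l <= c) ->
  tv A mu E <= c.
Proof.
  intros Hmu HE H. apply (tv_lub mu E Hmu HE). intros s [l [Hl ->]].
  apply partition_iff in Hl. apply H; try apply Hl.
Qed.

Lemma disjl_app (l l' : list (Omega -> Prop)) : disjl l -> disjl l' ->
  (forall x, ~ (bigU l x /\ bigU l' x)) -> disjl (l ++ l').
Proof.
  intros H H' Hd. induction H as [|E l HE Hl IH]; simpl; auto. constructor.
  - apply Forall_app; split; auto. apply Forall_forall. intros F HF x [H1 H2].
    apply (Hd x). split; apply bigU_In; [exists E|exists F]; simpl; auto.
  - apply IH. intros x [H1 H2]. apply (Hd x). rewrite bigU_cons. auto.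
Qed.

Lemma disjl_inter (l : list (Omega -> Prop)) E : disjl l -> disjl (map (fun F x => F x /\ E x) l).
Proof.
  induction 1 as [|F l HF Hl IH]; simpl; constructor; auto.
  rewrite Forall_map. eapply Forall_impl; [|exact HF]. simpl. intros G HG x [[] []]. apply (HG x); auto.
Qed.

Lemma alg_inter l E : A E -> Forall A l -> Forall A (map (fun F x => F x /\ E x) l).
Proof.
  intros HE Hl. rewrite Forall_map. eapply Forall_impl; [|exact Hl]. intros F HF.
  now apply alg_I.
Qed.

Lemma bigU_inter (l : list (Omega -> Prop)) E x :
  bigU (map (fun F x => F x /\ E x) l) x <-> bigU l x /\ E x.
Proof.
  rewrite !bigU_In. split.
  - intros [F [HF Fx]]. apply in_map_iff in HF. destruct HF as [G [<- HG]]. destruct Fx. eauto.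
  - intros [[F [HF Fx]] Ex]. exists (fun x => F x /\ E x). split; auto.
    apply in_map_iff; eauto.
Qed.

Lemma tv_fin_additive mu : in_ba A mu -> fin_additive A (tv A mu).
Proof.
  intros Hmu E F HE HF Hd. apply Rle_antisym.
  - apply tv_le; auto using alg_U. intros l H1 H2 H3.
    apply Rle_trans with (sum_abs mu (map (fun G x => G x /\ E x) l) +
      sum_abs mu (map (fun G x => G x /\ F x) l)).
    + unfold sum_abs. fold (lsum (fun F => Rabs (mu F)) l).
      change (lsum (fun G => Rabs (mu G)) l <=
        lsum (fun G => Rabs (mu G)) (map (fun G x => G x /\ E x) l) +
        lsum (fun G => Rabs (mu G)) (map (fun G x => G x /\ F x) l)).
      rewrite !lsum_map, <- lsum_plus. apply lsum_le_in. intros G HG.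
      rewrite Forall_forall in H1. assert (AG := H1 _ HG).
      eapply Rle_trans; [|apply Rabs_triang]. apply Req_le. f_equal.
      rewrite (add_split mu G E); auto; [|apply Hmu].
      f_equal. f_equal. apply set_ext; intros x. specialize (H3 x). specialize (Hd x).
      assert (G x -> bigU l x) by (intros Gx; apply bigU_In; eauto). tauto.
    + apply Rplus_le_compat; apply sum_abs_le_tv; auto using alg_inter, disjl_inter;
        intros x Hx; apply bigU_inter in Hx; tauto.
  (* Superadditivity: one supremum over families in E, then one over families in F, each taken with
     the other term moved across; the two families concatenate. *)
  - enough (H : tv A mu E <= tv A mu (fun x => E x \/ F x) - tv A mu F) by lra.
    apply tv_le; auto. intros l H1 H2 H3.
    enough (H : tv A mu F <= tv A mu (fun x => E x \/ F x) - sum_abs mu l) by lra.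
    apply tv_le; auto. intros l' H1' H2' H3'.
    enough (H : sum_abs mu (l ++ l') <= tv A mu (fun x => E x \/ F x)).
    { assert (H' : sum_abs mu (l ++ l') = sum_abs mu l + sum_abs mu l') by apply lsum_app. lra. }
    apply sum_abs_le_tv; auto using alg_U.
    + apply Forall_app; auto.
    + apply disjl_app; auto. intros x [Hx Hx']. apply (Hd x); auto.
    + intros x Hx. unfold bigU in Hx. apply Exists_app in Hx. destruct Hx; [left|right]; auto.
Qed.

Lemma abs_le_tv mu E : in_ba A mu -> A E -> Rabs (mu E) <= tv A mu E.
Proof.
  intros Hmu HE.
  assert (H := proj1 (tv_lub mu E Hmu HE) _ (ex_intro _ _ (conj (partition_1 E HE) eq_refl))).
  simpl in H. lra.
Qed.

Lemma tv_pos_add mu : in_ba A mu -> pos_add (tv A mu).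
Proof.
  intros Hmu. split; [now apply tv_fin_additive|]. intros E HE.
  eapply Rle_trans; [apply Rabs_pos|now apply abs_le_tv].
Qed.

Lemma pos_add_mono m E F : pos_add m -> A E -> A F -> (forall x, E x -> F x) -> m E <= m F.
Proof.
  intros [Hm Hp] HE HF H. rewrite (add_split m F E); auto.
  replace (fun x => F x /\ E x) with E.
  - assert (0 <= m (fun x => F x /\ ~ E x)) by (apply Hp, alg_D; auto). lra.
  - apply set_ext. intros x; specialize (H x); tauto.
Qed.

Lemma dominated_sum_abs mu m E l : pos_add m -> A E ->
  (forall F, A F -> Rabs (mu F) <= m F) ->
  Forall A l -> disjl l -> (forall x, bigU l x -> E x) -> sum_abs mu l <= m E.
Proof.
  intros Hm HE H H1 H2 H3. apply Rle_trans with (lsum m l).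
  - apply (lsum_le_in (fun F => Rabs (mu F))). rewrite Forall_forall in H1. auto.
  - rewrite <- add_bigU; auto; [|apply Hm]. apply pos_add_mono; auto using alg_bigU.
Qed.

Lemma dominated_in_ba mu m : fin_additive A mu -> pos_add m ->
  (forall F, A F -> Rabs (mu F) <= m F) -> in_ba A mu.
Proof.
  intros Hmu Hm H. split; auto. exists (m setT). intros l Hl. apply partition_iff in Hl.
  apply dominated_sum_abs; try apply Hl; auto using alg_T.
Qed.

Lemma dominated_tv mu m E : fin_additive A mu -> pos_add m ->
  (forall F, A F -> Rabs (mu F) <= m F) -> A E -> tv A mu E <= m E.
Proof.
  intros Hmu Hm H HE. apply tv_le; auto; [eapply dominated_in_ba; eauto|].
  intros l H1 H2 H3. apply dominated_sum_abs; auto.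
Qed.

Lemma pos_add_abs m E : pos_add m -> A E -> Rabs (m E) <= m E.
Proof. intros [_ H] HE. rewrite Rabs_right; [lra|]. apply Rle_ge; auto. Qed.

Lemma pos_add_in_ba m : pos_add m -> in_ba A m.
Proof. intros H. eapply dominated_in_ba; eauto using pos_add_abs. apply H. Qed.

Lemma lin_fin_additive mu nu a b : fin_additive A mu -> fin_additive A nu ->
  fin_additive A (fun E => a * mu E + b * nu E).
Proof. intros H H' E F HE HF Hd. rewrite H, H'; auto. ring. Qed.

Lemma lin_in_ba mu nu a b : in_ba A mu -> in_ba A nu ->
  in_ba A (fun E => a * mu E + b * nu E).
Proof.
  intros [H [C HC]] [H' [C' HC']]. split; [now apply lin_fin_additive|].
  exists (Rabs a * C + Rabs b * C'). intros l Hl.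
  apply Rle_trans with (Rabs a * sum_abs mu l + Rabs b * sum_abs nu l).
  - eapply Rle_trans; [|apply Req_le, (lsum_lin (Rabs a) (Rabs b))].
    apply (lsum_le_in (fun E => Rabs (a * mu E + b * nu E))). intros F _.
    eapply Rle_trans; [apply Rabs_triang|]. rewrite !Rabs_mult. lra.
  - apply Rplus_le_compat; apply Rmult_le_compat_l; auto using Rabs_pos.
Qed.

Lemma pos_add_plus m m' : pos_add m -> pos_add m' -> pos_add (fun E => m E + m' E).
Proof.
  intros [H1 H2] [H3 H4]. split.
  - intros E F HE HF Hd. rewrite H1, H3; auto. ring.
  - intros E HE. specialize (H2 E HE). specialize (H4 E HE). lra.
Qed.

Lemma zero_pos_add : pos_add (fun _ => 0).
Proof. split; [intros ? ? ? ? ?; ring|intros; lra]. Qed.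

(** * Restrictions, and sets that carry nearly half of the variation *)

Definition restr (m : (Omega -> Prop) -> R) (E : Omega -> Prop) : (Omega -> Prop) -> R :=
  fun F => m (fun x => E x /\ F x).

Lemma restr_fin_additive m E : fin_additive A m -> A E -> fin_additive A (restr m E).
Proof.
  intros H HE F G HF HG Hd. unfold restr. rewrite <- H; auto using alg_I.
  - f_equal. apply set_ext; intros x; tauto.
  - intros x; specialize (Hd x); tauto.
Qed.

Lemma restr_pos_add m E : pos_add m -> A E -> pos_add (restr m E).
Proof.
  intros [H H'] HE. split; [now apply restr_fin_additive|].
  intros F HF. apply H'. now apply alg_I.
Qed.

Lemma restr_le m E F : pos_add m -> A E -> A F -> restr m E F <= m F.
Proof. intros. unfold restr. apply pos_add_mono; auto using alg_I. tauto. Qed.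

(** Finite substitute for a Hahn decomposition: the union of the members on which mu is
    nonnegative. *)
Lemma pos_part_set mu l : fin_additive A mu -> Forall A l -> disjl l ->
  exists G, A G /\ (forall x, G x -> bigU l x) /\ mu G = lsum (fun F => Rmax (mu F) 0) l.
Proof.
  intros Hmu Hl Hd. induction Hd as [|E l HE Hd IH].
  - exists (fun _ => False). split; [apply alg_0|]. split; [tauto|]. simpl. now apply add_empty.
  - inversion_clear Hl. destruct IH as [G [AG [HG EG]]]; auto. simpl.
    destruct (Rle_dec 0 (mu E)).
    + exists (fun x => E x \/ G x). split; [now apply alg_U|]. split.
      * intros x. rewrite bigU_cons. specialize (HG x). tauto.
      * rewrite Hmu, EG, Rmax_left; auto. intros x [Ex Gx].
        apply HG, bigU_In in Gx. destruct Gx as [F [HF Fx]].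
        rewrite Forall_forall in HE. exact (HE F HF x (conj Ex Fx)).
    + exists G. split; auto. split.
      * intros x Gx. rewrite bigU_cons. auto.
      * rewrite EG, Rmax_right by lra. ring.
Qed.

Lemma opp_fin_additive mu : fin_additive A mu -> fin_additive A (fun E => - mu E).
Proof. intros H E F HE HF Hd. rewrite H; auto. ring. Qed.

(** The members with positive and those with negative value unite to two sets of the algebra, hence
    the factor 2. *)
Lemma tv_le_sets mu E c : in_ba A mu -> A E ->
  (forall G, A G -> (forall x, G x -> E x) -> Rabs (mu G) <= c) -> tv A mu E <= 2 * c.
Proof.
  intros Hmu HE H. apply tv_le; auto. intros l H1 H2 H3.
  destruct (pos_part_set mu l) as [G [AG [HG EG]]]; auto; [apply Hmu|].
  destruct (pos_part_set (fun E => - mu E) l) as [G' [AG' [HG' EG']]]; auto;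
    [apply opp_fin_additive, Hmu|].
  assert (Hs : sum_abs mu l = mu G + - mu G').
  { rewrite EG, EG', <- lsum_plus. apply lsum_ext_in. intros F _. cbv beta.
    unfold Rabs, Rmax. destruct Rcase_abs; repeat destruct Rle_dec; lra. }
  assert (B := H G AG (fun x h => H3 x (HG x h))).
  assert (B' := H G' AG' (fun x h => H3 x (HG' x h))).
  apply Rabs_le_inv in B. apply Rabs_le_inv in B'. lra.
Qed.

Lemma tv_set mu E c : in_ba A mu -> A E -> 2 * c < tv A mu E ->
  exists G, A G /\ (forall x, G x -> E x) /\ c < Rabs (mu G).
Proof.
  intros Hmu HE H. apply NNPP. intros Hn.
  assert (tv A mu E <= 2 * c); [|lra]. apply tv_le_sets; auto.
  intros G AG HG. apply Rnot_lt_le. intros Hlt. apply Hn; eauto.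
Qed.

Lemma ind_1 E x : E x -> ind E x = 1.
Proof. unfold ind. destruct excluded_middle_informative; tauto. Qed.

Lemma ind_0 E x : ~ E x -> ind E x = 0.
Proof. unfold ind. destruct excluded_middle_informative; tauto. Qed.

Lemma integ_restr m h E : fin_additive A m -> is_simple A h -> A E ->
  integ (restr m E) h = integ m (fun x => h x * ind E x).
Proof.
  intros Hm Hh HE. assert (Hp := labelling_pair h (ind E) Hh (labelling_ind E HE)).
  destruct (labelling_cover _ Hp) as [l [Hl Hc]].
  assert (E1 := integ_comp m _ (fun w => fst w * snd w) l Hm Hp Hl Hc).
  assert (E2 := integ_comp (restr m E) _ fst l (restr_fin_additive m E Hm HE) Hp Hl Hc).
  cbn [fst snd] in E1, E2. change (fun x => h x) with h in E2. rewrite E1, E2.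
  apply lsum_ext_in. intros [v w] _. unfold restr. simpl.
  destruct (Req_dec w 1) as [->|H1]; [|destruct (Req_dec w 0) as [->|H0]].
  - rewrite Rmult_1_r. f_equal. f_equal. apply set_ext; intros x. split; [tauto|].
    intros H. split; auto. injection H as _ H. apply NNPP. intros Hn. rewrite ind_0 in H; auto. lra.
  - rewrite (add_empty m (fun x => E x /\ _)); auto; [ring|].
    intros x [Ex H]. injection H as _ H. rewrite (ind_1 E x Ex) in H. lra.
  - assert (Hne : forall x, (h x, ind E x) <> (v, w)).
    { intros x H. injection H as _ H. unfold ind in H. destruct excluded_middle_informative; auto. }
    rewrite (add_empty m (fun x => E x /\ _)), (add_empty m (fun x => _ = _)); auto; [ring|].
    intros x [_ H]; eapply Hne; eauto.
Qed.

(** * Approximate densities and functionals on ba *)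

(** With the functional written as a sum over the fibres of [s], truncation and upper bounds become
    inequalities between quadratics in one real variable. *)
Lemma hellinger_comp nu lam s (c : R -> R) :
  fin_additive A nu -> fin_additive A lam -> is_simple A s ->
  2 * integ nu (fun x => c (s x)) - integ lam (fun x => c (s x) * c (s x)) =
  lsum (fun v => 2 * c v * nu (fun x => s x = v) - c v * c v * lam (fun x => s x = v))
    (range_list s).
Proof.
  intros Hn Hl Hs. destruct (range_list_spec s Hs) as [H1 H2].
  rewrite (integ_comp nu s c _ Hn Hs H1 H2).
  rewrite (integ_comp lam s (fun v => c v * c v) _ Hl Hs H1 H2).
  rewrite <- (Rmult_1_l (lsum _ _)), <- Rmult_assoc.
  replace (_ - _) with (2 * 1 * lsum (fun w => c w * nu (fun x => s x = w)) (range_list s)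
    + (-1) * lsum (fun w => c w * c w * lam (fun x => s x = w)) (range_list s)) by ring.
  rewrite <- lsum_lin. apply lsum_ext_in. intros; ring.
Qed.

(* The maximizers of the concave quadratic functional [2 nu(s) - lam(s^2)] are the densities
   of [nu]; a near-maximizer exists without any completeness of [L^2(lam)], and the first
   variation makes it an approximate density. *)
Lemma approx_density nu lam K eps : fin_additive A nu -> pos_add lam -> 0 < eps -> 0 <= K ->
  (forall E, A E -> Rabs (nu E) <= K * lam E) ->
  exists s, is_simple A s /\ (forall x, Rabs (s x) <= K) /\
    forall g, is_simple A g -> (forall x, Rabs (g x) <= 1) ->
      Rabs (integ nu g - integ lam (fun x => s x * g x)) <= eps.
Proof.
  intros Hn Hl He HK Hd.
  pose (J := fun s => 2 * integ nu s - integ lam (fun x => s x * s x)).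
  set (La := lam setT). assert (HLa : 0 <= La) by (apply Hl, alg_T).
  (* Testing near-maximality, with slack [tau * eps], at s + tau g and s - tau g gives 2 tau |D| <=
     tau eps + tau^2 La <= 2 tau eps for the error D to be bounded. *)
  set (tau := eps / (La + 1)). assert (Ht : 0 < tau) by (apply Rdiv_lt_0_compat; lra).
  assert (HtL : tau * La <= eps).
  { assert (tau * (La + 1) = eps) by (unfold tau; field; lra). nra. }
  (* On a fibre, 2 v n - v^2 la is concave in v with a maximizer in [-K, K], because |n| <= K la;
     clamping v to this interval cannot lower it. *)
  assert (HJT : forall s, is_simple A s -> exists s', is_simple A s' /\
    (forall x, Rabs (s' x) <= K) /\ J s <= J s').
  { intros s Hs. pose (T := fun v => Rmax (- K) (Rmin v K)).
    exists (fun x => T (s x)). split; [now apply simple_comp|]. split.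
    - intros x. unfold T. apply Rabs_le. unfold Rmax, Rmin. repeat destruct Rle_dec; lra.
    - unfold J. assert (E1 := hellinger_comp nu lam s (fun v => v) Hn (proj1 Hl) Hs).
      assert (E2 := hellinger_comp nu lam s T Hn (proj1 Hl) Hs).
      cbv beta in E1. change (fun x => s x) with s in E1. rewrite E1, E2.
      apply lsum_le_in. intros v _.
      assert (AE : A (fun x => s x = v)) by apply Hs.
      assert (B := Hd _ AE). assert (B0 := proj2 Hl _ AE).
      set (n := nu (fun x => s x = v)) in *. set (la := lam (fun x => s x = v)) in *. apply Rabs_le_inv in B.
      unfold T, Rmax, Rmin. destruct (Rle_dec v K).
      + destruct (Rle_dec (- K) v); [lra|].
        assert (0 <= (- K - v) * (n + K * la)) by (apply Rmult_le_pos; lra).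
        assert (0 <= (- K - v) * ((- K - v) * la)) by (repeat apply Rmult_le_pos; lra).
        lra.
      + destruct (Rle_dec (- K) K); [|lra].
        assert (0 <= (v - K) * (K * la - n)) by (apply Rmult_le_pos; lra).
        assert (0 <= (v - K) * ((v - K) * la)) by (repeat apply Rmult_le_pos; lra).
        lra. }
  (* Fibrewise, 2 v n <= 2 |v| K la <= (v^2 + K^2) la, so the functional has a finite supremum. *)
  assert (HJb : forall s, is_simple A s -> J s <= K * K * La).
  { intros s Hs. unfold J. assert (E1 := hellinger_comp nu lam s (fun v => v) Hn (proj1 Hl) Hs).
    cbv beta in E1. change (fun x => s x) with s in E1. rewrite E1.
    destruct (range_list_spec s Hs) as [H1 H2].
    assert (E2 := integ_comp lam s (fun _ => K * K) _ (proj1 Hl) Hs H1 H2).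
    cbv beta in E2. rewrite integ_const in E2; [|apply Hl]. fold La in E2. rewrite E2.
    apply lsum_le_in. intros v _.
    assert (AE : A (fun x => s x = v)) by apply Hs.
    assert (B := Hd _ AE). assert (B0 := proj2 Hl _ AE).
    set (n := nu (fun x => s x = v)) in *. set (la := lam (fun x => s x = v)) in *. apply Rabs_le_inv in B.
    assert (0 <= (v - K) * (v - K) * la) by (apply Rmult_le_pos; auto; exact (Rle_0_sqr _)).
    assert (0 <= (v + K) * (v + K) * la) by (apply Rmult_le_pos; auto; exact (Rle_0_sqr _)).
    destruct (Rle_dec 0 v) as [Hv|Hv].
    - assert (0 <= v * (K * la - n)) by (apply Rmult_le_pos; lra). lra.
    - assert (0 <= (- v) * (n + K * la)) by (apply Rmult_le_pos; lra). lra. }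
  assert (HJs : exists s, is_simple A s /\ forall s', is_simple A s' -> J s' <= J s + tau * eps).
  { destruct (completeness (fun r => exists s, is_simple A s /\ r = J s)) as [S [HS1 HS2]].
    - exists (K * K * La). intros r [s [Hs ->]]. auto.
    - exists (J (fun _ => 0)). exists (fun _ => 0). split; auto using simple_const.
    - apply NNPP. intros Hno.
      assert (0 < tau * eps) by nra.
      assert (S <= S - tau * eps); [|lra]. apply HS2. intros r [s [Hs ->]].
      apply Rnot_lt_le. intros Hlt. apply Hno. exists s. split; auto.
      intros s' Hs'. assert (J s' <= S) by (apply HS1; eauto). lra. }
  destruct HJs as [s0 [Hs0 Hmax0]]. destruct (HJT s0 Hs0) as [s [Hs [HsK Hss]]].
  exists s. split; auto. split; auto. intros g Hg Hg1.
  assert (Hvar : forall t, J (fun x => 1 * s x + t * g x) =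
    J s + 2 * t * (integ nu g - integ lam (fun x => s x * g x))
      - t * t * integ lam (fun x => g x * g x)).
  { intros t. unfold J. rewrite integ_lin; auto.
    assert (Hsg := simple_comp2 Rmult s g Hs Hg). assert (Hsq := simple_comp2 Rmult s s Hs Hs).
    assert (Hgg := simple_comp2 Rmult g g Hg Hg).
    replace (fun x => (1 * s x + t * g x) * (1 * s x + t * g x)) with
      (fun x => 1 * (s x * s x) + 1 * (2 * t * (s x * g x) + t * t * (g x * g x)))
      by (extensionality x; ring).
    rewrite (integ_lin lam (fun x => s x * s x)
      (fun x => 2 * t * (s x * g x) + t * t * (g x * g x))); auto; [|apply Hl|].
    - rewrite (integ_lin lam (fun x => s x * g x) (fun x => g x * g x)); auto; [ring|apply Hl].
    - exact (simple_comp2 (fun a b => 2 * t * a + t * t * b) _ _ Hsg Hgg). }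
  assert (Hgg : integ lam (fun x => g x * g x) <= La).
  { replace La with (integ lam (fun _ => 1)) by (rewrite integ_const; [unfold La; ring|apply Hl]).
    apply integ_le; auto using simple_const.
    - now apply (simple_comp2 Rmult).
    - intros x. specialize (Hg1 x). apply Rabs_le_inv in Hg1. nra. }
  assert (V : forall t, J (fun x => 1 * s x + t * g x) <= J s + tau * eps).
  { intros t. apply Rle_trans with (J s0 + tau * eps); [|lra]. apply Hmax0.
    exact (simple_comp2 (fun a b => 1 * a + t * b) s g Hs Hg). }
  assert (V1 := V tau). assert (V2 := V (- tau)). rewrite Hvar in V1, V2.
  set (D := integ nu g - integ lam (fun x => s x * g x)) in *.
  set (q := integ lam (fun x => g x * g x)) in *.
  assert (tau * q <= eps) by (eapply Rle_trans; [|exact HtL]; apply Rmult_le_compat_l; lra).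
  assert (tau * (tau * q) <= tau * eps) by (apply Rmult_le_compat_l; lra).
  apply Rabs_le. split; apply (Rmult_le_reg_l tau); lra.
Qed.

(** [ba_dual] with an explicit constant, which must be uniform along a sequence of functionals for
    their Banach limit to be bounded. *)
Definition dual_le (K : R) (phi : ((Omega -> Prop) -> R) -> R) : Prop :=
  (forall a b nu nu', in_ba A nu -> in_ba A nu' ->
     phi (fun E => a * nu E + b * nu' E) = a * phi nu + b * phi nu') /\
  (forall nu, in_ba A nu -> Rabs (phi nu) <= K * ba_norm A nu).

Lemma ba_norm_ge0 mu : in_ba A mu -> 0 <= ba_norm A mu.
Proof. intros H. apply (tv_pos_add mu H), alg_T. Qed.

Lemma ba_dual_le phi : ba_dual A phi -> exists K, 0 < K /\ dual_le K phi.
Proof.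
  intros [H1 [K HK]]. exists (Rmax K 1). split.
  - apply Rlt_le_trans with 1; [lra|apply Rmax_r].
  - split; auto. intros nu Hnu. eapply Rle_trans; [apply HK; auto|].
    apply Rmult_le_compat_r; [now apply ba_norm_ge0|apply Rmax_l].
Qed.

Lemma dual_le_ba phi K : dual_le K phi -> ba_dual A phi.
Proof. intros [H1 H2]. split; eauto. Qed.

(** [tv_le_sets] turns uniform setwise closeness into norm closeness. With c = 0 it says that phi
    sees only the values on A. *)
Lemma dual_diff phi K nu nu' c : dual_le K phi -> 0 < K -> in_ba A nu -> in_ba A nu' ->
  (forall E, A E -> Rabs (nu E - nu' E) <= c) -> Rabs (phi nu - phi nu') <= K * (2 * c).
Proof.
  intros [H1 H2] HK Hn Hn' Hc. assert (Hb := lin_in_ba nu nu' 1 (-1) Hn Hn').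
  replace (phi nu - phi nu') with (phi (fun E => 1 * nu E + -1 * nu' E)) by (rewrite H1; auto; ring).
  eapply Rle_trans; [apply H2; auto|]. apply Rmult_le_compat_l; [lra|].
  apply tv_le_sets; auto using alg_T. intros G AG _. replace (_ + _) with (nu G - nu' G) by ring.
  auto.
Qed.

Lemma dual_lsum {T} phi K (c : T -> R) (m : T -> (Omega -> Prop) -> R) l : dual_le K phi ->
  (forall v, In v l -> in_ba A (m v)) ->
  in_ba A (fun E => lsum (fun v => c v * m v E) l) /\
  phi (fun E => lsum (fun v => c v * m v E) l) = lsum (fun v => c v * phi (m v)) l.
Proof.
  intros [H1 _] Hm. assert (Hz := pos_add_in_ba _ zero_pos_add).
  induction l as [|a l IH].
  - simpl. split; auto. assert (H := H1 0 0 _ _ Hz Hz). cbv beta in H.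
    replace (fun _ : Omega -> Prop => 0 * 0 + 0 * 0) with (fun _ : Omega -> Prop => 0) in H
      by (extensionality E; ring). lra.
  - assert (Ha : in_ba A (m a)) by (apply Hm; simpl; auto).
    destruct IH as [I1 I2]; [intros; apply Hm; simpl; auto|].
    replace (fun E => lsum (fun v => c v * m v E) (a :: l)) with
      (fun E => c a * m a E + 1 * lsum (fun v => c v * m v E) l)
      by (extensionality E; simpl; ring).
    split; [now apply lin_in_ba|]. rewrite H1, I2; auto. simpl. ring.
Qed.

(* [theta E := phi (lam restricted to E)] is dominated by [K lam]; its approximate density is the
   simple function representing [phi]. *)
Lemma dual_dominated phi K lam eps : dual_le K phi -> 0 < K -> pos_add lam -> 0 < eps ->
  exists s, is_simple A s /\ (forall x, Rabs (s x) <= K) /\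
    forall nu, fin_additive A nu -> (forall E, A E -> Rabs (nu E) <= lam E) ->
      Rabs (phi nu - integ nu s) <= eps.
Proof.
  (* The three errors below are 2 K e, e and K e. *)
  intros Hphi HK Hl He. set (e := eps / (3 * K + 1)).
  assert (He' : 0 < e) by (apply Rdiv_lt_0_compat; lra).
  assert (Hee : (3 * K + 1) * e = eps) by (unfold e; field; lra).
  pose (theta := fun E => phi (restr lam E)).
  assert (Hrb : forall E, A E -> in_ba A (restr lam E))
    by (intros; apply pos_add_in_ba, restr_pos_add; auto).
  assert (Hta : fin_additive A theta).
  { intros E F HE HF Hd. unfold theta.
    replace (phi (restr lam E) + phi (restr lam F)) with
      (phi (fun G => 1 * restr lam E G + 1 * restr lam F G)) by (rewrite (proj1 Hphi); auto; ring).
    (* The two set functions agree on A but possibly not off it, so [dual_diff] with bound 0 takes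
       the place of a rewriting step. *)
    assert (B : Rabs (phi (restr lam (fun x => E x \/ F x)) -
      phi (fun G => 1 * restr lam E G + 1 * restr lam F G)) <= K * (2 * 0)).
    { apply dual_diff; auto using alg_U, lin_in_ba. intros G HG. unfold restr.
      replace (fun x => (E x \/ F x) /\ G x) with (fun x => (E x /\ G x) \/ (F x /\ G x))
        by (apply set_ext; intros x; tauto).
      rewrite (proj1 Hl); auto using alg_I; [|intros x; specialize (Hd x); tauto].
      rewrite Rabs_right; lra. }
    apply Rabs_le_inv in B. lra. }
  assert (Htb : forall E, A E -> Rabs (theta E) <= K * lam E).
  { intros E HE. eapply Rle_trans; [apply (proj2 Hphi); auto|].
    apply Rmult_le_compat_l; [lra|].
    assert (Hp := restr_pos_add lam E Hl HE).
    eapply Rle_trans; [apply (dominated_tv (restr lam E) (restr lam E) setT (proj1 Hp) Hp)|].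
    - intros; now apply pos_add_abs.
    - apply alg_T.
    - unfold restr. apply pos_add_mono; auto using alg_I, alg_T. tauto. }
  destruct (approx_density theta lam K e Hta Hl He' (Rlt_le _ _ HK) Htb) as [s [Hs [HsK Hsg]]].
  exists s. split; auto. split; auto. intros nu Hnu Hd.
  (* Now nu itself gets an approximate density [h]. The measure with density [h] is [hl], a finite
     combination of restrictions of [lam], so phi takes on it the value of the integral of [h]
     against [theta]. *)
  destruct (approx_density nu lam 1 e Hnu Hl He' Rle_0_1) as [h [Hh [Hh1 Hhg]]];
    [intros; rewrite Rmult_1_l; auto|].
  pose (hl := fun E => lsum (fun v => v * restr lam (fun x => h x = v) E) (range_list h)).
  destruct (dual_lsum phi K (fun v => v) (fun v => restr lam (fun x => h x = v)) (range_list h) Hphi)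
    as [Hlb Hlp]; [intros v _; apply Hrb, Hh|].
  cbv beta in Hlb, Hlp. fold hl in Hlb, Hlp.
  change (phi hl = integ theta h) in Hlp.
  assert (Hhl : forall E, A E -> hl E = integ lam (fun x => h x * ind E x)).
  { intros E HE. rewrite <- integ_restr; auto; [|apply Hl]. unfold hl, integ.
    apply lsum_ext_in. intros v _. unfold restr. f_equal. f_equal. apply set_ext; tauto. }
  assert (B1 : Rabs (phi nu - phi hl) <= K * (2 * e)).
  { apply dual_diff; auto. { eapply dominated_in_ba; eauto. }
    intros E HE. rewrite Hhl; auto. rewrite <- (integ_ind nu E) by auto.
    apply Hhg; auto using labelling_ind.
    - exact (labelling_ind E HE).
    - intros x. unfold ind. destruct excluded_middle_informative;
      rewrite ?Rabs_R1, ?Rabs_R0; lra. }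
  assert (B2 := Hsg h Hh Hh1). rewrite <- Hlp in B2.
  (* Test functions are bounded by 1, so s / K is tested and the result rescaled. *)
  assert (B3 : Rabs (integ nu s - integ lam (fun x => s x * h x)) <= K * e).
  { assert (Hsc := simple_comp (fun v => / K * v) s Hs).
    assert (B := Hhg _ Hsc). cbv beta in B.
    assert (E1 : integ nu (fun x => / K * s x) = / K * integ nu s).
    { assert (E := integ_lin nu s s (/ K) 0 Hnu Hs Hs).
      replace (fun x => / K * s x) with (fun x => / K * s x + 0 * s x)
        by (extensionality x; ring). lra. }
    assert (E2 : integ lam (fun x => h x * (/ K * s x)) = / K * integ lam (fun x => s x * h x)).
    { assert (Hsh := simple_comp2 Rmult s h Hs Hh).
      assert (E := integ_lin lam _ _ (/ K) 0 (proj1 Hl) Hsh Hsh).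
      replace (fun x => h x * (/ K * s x)) with (fun x => / K * (s x * h x) + 0 * (s x * h x))
        by (extensionality x; ring). lra. }
    rewrite E1, E2, <- Rmult_minus_distr_l, Rabs_mult in B.
    assert (HK' := Rinv_0_lt_compat K HK). rewrite (Rabs_right (/ K)) in B by lra.
    apply (Rmult_le_reg_l (/ K)); auto. rewrite <- Rmult_assoc, Rinv_l, Rmult_1_l by lra.
    apply B. intros x. rewrite Rabs_mult, (Rabs_right (/ K)) by lra.
    apply (Rmult_le_reg_l K); auto. rewrite <- Rmult_assoc, Rinv_r, Rmult_1_l, Rmult_1_r by lra.
    auto. }
  apply Rabs_le_inv in B1. apply Rabs_le_inv in B2. apply Rabs_le_inv in B3.
  apply Rabs_le. split; lra.
Qed.

(** [lam] is chosen after [eps], so finite sums of variations can serve and no series of measures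
    has to be summed. *)
Definition unif_abs_cont (S : ((Omega -> Prop) -> R) -> Prop) : Prop :=
  forall eps, 0 < eps -> exists lam d, pos_add lam /\ 0 < d /\
    forall mu, S mu -> forall E, A E -> lam E < d -> tv A mu E <= eps.

(* The simple function [s] obtained from [lam] does not depend on [mu]. For each [mu] a second one,
   [s'], obtained from [lam + |mu|], approximates [phi mu]; both approximate [phi] on the measures
   dominated by [lam], so they differ only on a set of small [lam]-measure, hence of small
   [|mu|]-measure. *)
Lemma dual_approx (S : ((Omega -> Prop) -> R) -> Prop) C phi eps :
  0 <= C -> (forall mu, S mu -> in_ba A mu /\ ba_norm A mu <= C) -> unif_abs_cont S ->
  ba_dual A phi -> 0 < eps ->
  exists s, is_simple A s /\ forall mu, S mu -> Rabs (phi mu - integ mu s) <= eps.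
Proof.
  intros HC HS Hac Hphi He. destruct (ba_dual_le phi Hphi) as [K [HK HphiK]].
  (* Error budget: eps/4 between phi and [s'] at mu, eps/4 where |s - s'| <= eta, and eps/4 from the
     exceptional set, where |s - s'| <= 2 K and the variation of mu is at most eps/(8 K). The bound
     [d * eta / 8] in [e'] makes the exceptional set small for [lam]. *)
  set (eta := eps / (4 * (C + 1))).
  assert (Heta : 0 < eta) by (apply Rdiv_lt_0_compat; lra).
  assert (Eeta : eta * C <= eps / 4).
  { assert (eta * (C + 1) = eps / 4) by (unfold eta; field; lra). lra. }
  assert (He1 : 0 < eps / (8 * K)) by (apply Rdiv_lt_0_compat; lra).
  destruct (Hac _ He1) as [lam [d [Hl [Hd Hlac]]]].
  set (e' := Rmin (eps / 4) (d * eta / 8)).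
  assert (He' : 0 < e').
  { apply Rmin_glb_lt; [lra|]. assert (0 < d * eta) by now apply Rmult_lt_0_compat. lra. }
  destruct (dual_dominated phi K lam e' HphiK HK Hl He') as [s [Hs [HsK Hsa]]].
  exists s. split; auto. intros mu Hmu. destruct (HS mu Hmu) as [Hb Hn].
  assert (Htp := tv_pos_add mu Hb).
  destruct (dual_dominated phi K _ e' HphiK HK (pos_add_plus lam (tv A mu) Hl Htp) He')
    as [s' [Hs' [HsK' Hsa']]].
  assert (B1 : Rabs (phi mu - integ mu s') <= eps / 4).
  { eapply Rle_trans; [apply Hsa'; [apply Hb|]|apply Rmin_l].
    intros E HE. assert (H1 := abs_le_tv mu E Hb HE). assert (H2 := proj2 Hl E HE). lra. }
  (* The measure to test is [lam] restricted to the very set E where u - v exceeds eta: eta lam(E)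
     <= 2 e' <= d eta / 4. *)
  assert (Hcheb : forall u v, is_simple A u -> is_simple A v ->
    (forall nu, fin_additive A nu -> (forall E, A E -> Rabs (nu E) <= lam E) ->
       integ nu u - integ nu v <= 2 * e') -> 2 * lam (fun x => u x - v x > eta) < d).
  { intros u v Hu Hv H. set (E := fun x => u x - v x > eta).
    assert (Huv := simple_comp2 (fun a b => 1 * a + (-1) * b) u v Hu Hv). cbv beta in Huv.
    assert (HE : A E).
    { assert (AE := labelling_pred _ (fun w => w > eta) Huv). cbv beta in AE.
      replace E with (fun x => 1 * u x + -1 * v x > eta); auto.
      unfold E. apply set_ext; intros x; split; lra. }
    assert (H1 := H (restr lam E)). assert (Hrp := restr_pos_add lam E Hl HE).
    rewrite <- (Rmult_1_l (integ _ u)) in H1.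
    replace (1 * integ (restr lam E) u - integ (restr lam E) v) with
      (1 * integ (restr lam E) u + (-1) * integ (restr lam E) v) in H1 by ring.
    rewrite <- integ_lin in H1; auto; try apply Hrp.
    rewrite integ_restr in H1; auto; try apply Hl.
    assert (H2 : integ lam (fun x => eta * ind E x + 0 * ind E x) <=
      integ lam (fun x => (1 * u x + -1 * v x) * ind E x)).
    { apply integ_le; auto.
      - exact (simple_comp (fun t => eta * t + 0 * t) _ (labelling_ind E HE)).
      - exact (simple_comp2 Rmult _ _ Huv (labelling_ind E HE)).
      - intros x. destruct (classic (E x)) as [Ex|Ex].
        + rewrite ind_1; auto. unfold E in Ex. lra.
        + rewrite ind_0; auto. lra. }
    rewrite integ_lin, integ_ind in H2; auto; try apply Hl; try exact (labelling_ind E HE).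
    assert (H3 : integ lam (fun x => (1 * u x + -1 * v x) * ind E x) <= 2 * e').
    { apply H1; [apply Hrp|]. intros F HF. eapply Rle_trans; [now apply pos_add_abs|].
      now apply restr_le. }
    assert (e' <= d * eta / 8) by apply Rmin_r.
    apply (Rmult_lt_reg_l eta); auto. assert (0 < d * eta) by now apply Rmult_lt_0_compat. lra. }
  assert (Hcmp : forall nu, fin_additive A nu -> (forall E, A E -> Rabs (nu E) <= lam E) ->
    Rabs (phi nu - integ nu s) <= e' /\ Rabs (phi nu - integ nu s') <= e').
  { intros nu H1 H2. split; auto. apply Hsa'; auto. intros E HE.
    assert (H3 := proj2 Htp E HE). specialize (H2 E HE). lra. }
  assert (L1 := Hcheb s s' Hs Hs'). assert (L2 := Hcheb s' s Hs' Hs).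
  set (P := fun x => s x - s' x > eta) in *. set (Q := fun x => s' x - s x > eta) in *.
  assert (Hdf := simple_comp2 (fun a b => 1 * a + (-1) * b) s s' Hs Hs'). cbv beta in Hdf.
  assert (HPQ : A (fun x => P x \/ Q x)).
  { assert (AE := labelling_pred _ (fun w => w > eta \/ - w > eta) Hdf). cbv beta in AE.
    erewrite set_ext; [exact AE|]. unfold P, Q. intros x; simpl.
    split; intros []; [left|right|left|right]; lra. }
  assert (HP : A P).
  { assert (AE := labelling_pred _ (fun w => w > eta) Hdf). cbv beta in AE.
    erewrite set_ext; [exact AE|]. unfold P. intros x; simpl. lra. }
  assert (HQ : A Q).
  { assert (AE := labelling_pred _ (fun w => - w > eta) Hdf). cbv beta in AE.
    erewrite set_ext; [exact AE|]. unfold Q. intros x; simpl. lra. }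
  assert (HlPQ : lam (fun x => P x \/ Q x) < d).
  { rewrite (proj1 Hl); auto; [|unfold P, Q; intros x; lra].
    enough (2 * lam P < d /\ 2 * lam Q < d) by lra. split; [apply L1|apply L2];
    intros nu H1 H2; destruct (Hcmp nu H1 H2) as [H3 H4]; apply Rabs_le_inv in H3, H4; lra. }
  assert (Htv := Hlac mu Hmu _ HPQ HlPQ).
  assert (B2 : Rabs (integ mu (fun x => 1 * s x + -1 * s' x)) <= eps / 2).
  { eapply Rle_trans; [apply (integ_abs mu (tv A mu)); auto; try apply Hb; try apply Htp|].
    - intros; now apply abs_le_tv.
    - eapply Rle_trans; [apply (integ_le _ _
        (fun x => 2 * K * ind (fun x => P x \/ Q x) x + eta * 1)); auto|].
      + exact (simple_comp Rabs _ Hdf).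
      + exact (simple_comp (fun t => 2 * K * t + eta * 1) _ (labelling_ind _ HPQ)).
      + intros x. specialize (HsK x). specialize (HsK' x).
        apply Rabs_le_inv in HsK, HsK'. apply Rabs_le. destruct (classic (P x \/ Q x)) as [Hx|Hx].
        * rewrite ind_1; auto. lra.
        * rewrite ind_0; auto. unfold P, Q in Hx. lra.
      + rewrite (integ_lin (tv A mu) _ (fun _ => 1)); auto using simple_const;
          [|apply Htp|exact (labelling_ind _ HPQ)].
        rewrite integ_ind, integ_const; auto; try apply Htp.
        unfold ba_norm in Hn.
        assert (2 * K * tv A mu (fun x => P x \/ Q x) <= 2 * K * (eps / (8 * K)))
          by (apply Rmult_le_compat_l; lra).
        replace (2 * K * (eps / (8 * K))) with (eps / 4) in H by (field; lra).
        assert (eta * tv A mu setT <= eta * C) by (apply Rmult_le_compat_l; lra). lra. }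
  rewrite integ_lin in B2; auto; [|apply Hb].
  apply Rabs_le_inv in B1, B2. apply Rabs_le. split; lra.
Qed.

(** * Weak compactness from the uniform Cauchy property *)

(** Otherwise measures and sets can be chosen with |m_n|(E_n) > eps and |m_i|(E_n) < 1/(n+1) for i <
    n. The indicators of the E_n then tend to 0 in each L^1(m_i), but not uniformly in i. *)
Lemma unif_cauchy_abs_cont (M : ((Omega -> Prop) -> R) -> Prop) :
  (forall mu, M mu -> in_ba A mu) -> uniform_cauchy A M -> unif_abs_cont M.
Proof.
  intros HM HU eps He. apply NNPP. intros Hno.
  destruct (dependent_choice_list (X := ((Omega -> Prop) -> R) * (Omega -> Prop))
    (fun w => M (fst w) /\ A (snd w))
    (fun l w => (forall v, In v l -> tv A (fst v) (snd w) < / INR (S (length l))) /\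
       eps < tv A (fst w) (snd w))) as [u Hu].
  - intros l Hl.
    assert (Hd : 0 < / INR (S (length l))) by (apply Rinv_0_lt_compat, lt_0_INR; lia).
    set (d := / INR (S (length l))) in *.
    (* Failure of absolute continuity for the sum of the variations chosen so far makes each of them
       small on the new set. *)
    set (lam := fun E => lsum (fun v => tv A (fst v) E) l).
    assert (Hlam : pos_add lam).
    { unfold lam. clear - hA HM Hl. induction Hl as [|w l [Hw _] Hl IH]; simpl.
      - exact zero_pos_add.
      - exact (pos_add_plus _ _ (tv_pos_add _ (HM _ Hw)) IH). }
    apply NNPP. intros Hn. apply Hno. exists lam, d. split; auto. split; auto.
    intros mu Hmu E HE HlE. apply Rnot_lt_le. intros Hlt. apply Hn. exists (mu, E). simpl.
    split; auto. split; auto. intros v Hv. eapply Rle_lt_trans; [|exact HlE].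
    apply (lsum_in_le (fun v => tv A (fst v) E)); auto.
    intros w Hw. rewrite Forall_forall in Hl. apply (tv_pos_add _ (HM _ (proj1 (Hl w Hw)))); auto.
  - pose (m := fun n => fst (u n)). pose (E := fun n => snd (u n)).
    assert (Mm : forall n, M (m n)) by (intros n; apply Hu).
    assert (AE : forall n, A (E n)) by (intros n; apply Hu).
    assert (Hlow : forall n, eps < tv A (m n) (E n)) by (intros n; apply Hu).
    assert (Hup : forall i n, (i < n)%nat -> tv A (m i) (E n) < / INR (S n)).
    { intros i n Hin. destruct (Hu n) as [_ [H _]].
      rewrite length_map, length_seq in H. apply H. apply in_map_iff. exists i. split; auto.
      apply in_seq. lia. }
    assert (Hsi : forall n, is_simple A (ind (E n))) by (intros n; exact (labelling_ind _ (AE n))).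
    assert (Hdf : forall a b, is_simple A (fun x => Rabs (ind (E a) x - ind (E b) x)))
      by (intros a b; exact (simple_comp2 (fun s t => Rabs (s - t)) _ _ (Hsi a) (Hsi b))).
    assert (Hle : forall i a b,
      abs_integ A (m i) (fun x => ind (E a) x - ind (E b) x) <= tv A (m i) (E a) + tv A (m i) (E b)
      /\ tv A (m i) (E a) - tv A (m i) (E b) <= abs_integ A (m i) (fun x => ind (E a) x - ind (E b) x)).
    { intros i a b. assert (Hp := tv_pos_add _ (HM _ (Mm i))). unfold abs_integ. split.
      - rewrite <- (integ_ind (tv A (m i)) (E a)), <- (integ_ind (tv A (m i)) (E b)); auto; try apply Hp.
        rewrite <- (Rmult_1_l (integ _ (ind (E a)))), <- (Rmult_1_l (integ _ (ind (E b)))).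
        rewrite <- integ_lin; auto; try apply Hp. apply integ_le; auto.
        + exact (simple_comp2 (fun s t => 1 * s + 1 * t) _ _ (Hsi a) (Hsi b)).
        + intros x. apply Rabs_le. unfold ind. repeat destruct excluded_middle_informative; lra.
      - rewrite <- (integ_ind (tv A (m i)) (E a)), <- (integ_ind (tv A (m i)) (E b)); auto; try apply Hp.
        apply Rle_trans with (1 * integ (tv A (m i)) (ind (E a)) + (-1) * integ (tv A (m i)) (ind (E b)));
          [lra|].
        rewrite <- integ_lin; auto; try apply Hp. apply integ_le; auto.
        + exact (simple_comp2 (fun s t => 1 * s + (-1) * t) _ _ (Hsi a) (Hsi b)).
        + intros x. eapply Rle_trans; [|apply Rle_abs]. lra. }
    assert (Hinv : forall e, 0 < e -> exists N, (0 < N)%nat /\ forall n, (N <= n)%nat -> / INR (S n) < e).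
    { intros e He0. destruct (archimed_cor1 e He0) as [N [HN1 HN2]]. exists N. split; auto.
      intros n Hn. eapply Rle_lt_trans; [|exact HN1]. apply Rinv_le_contravar.
      - apply lt_0_INR; lia.
      - apply le_INR; lia. }
    destruct (HU (fun mu => exists i, mu = m i) (fun n => ind (E n))) with (eps := eps / 4)
      as [N HN]; auto.
    + intros mu [i ->]; auto.
    + exists 1. intros n x. unfold ind. destruct excluded_middle_informative;
        rewrite ?Rabs_R0, ?Rabs_R1; lra.
    + intros mu [i ->] e He0. destruct (Hinv (e / 2)) as [N [HN1 HN2]]; [lra|].
      exists (N + i)%nat. intros n Hn p q. eapply Rle_trans; [apply Hle|].
      assert (H1 : forall k, tv A (m i) (E (n + k)%nat) < e / 2).
      { intros k. eapply Rlt_trans; [apply Hup; lia|]. apply HN2; lia. }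
      assert (H2 := H1 p). assert (H3 := H1 q). lra.
    + lra.
    + destruct (Hinv (eps / 4)) as [N' [HN1 HN2]]; [lra|].
      (* The measure [m N] refutes the bound at stage N: it gives E_N variation above eps and
         E_(N+N') less than eps/4. [0 < N'] makes the second set strictly later. *)
      assert (H := HN N (le_n _) (m N) (ex_intro _ N eq_refl) 0%nat N').
      assert (H1 := proj2 (Hle N (N + 0)%nat (N + N')%nat)). cbv beta in H.
      assert (H2 := Hlow N). rewrite Nat.add_0_r in *.
      assert (H3 : tv A (m N) (E (N + N')%nat) < eps / 4).
      { eapply Rlt_trans; [apply Hup; lia|]. apply HN2; lia. }
      lra.
Qed.

(** * Weak neighbourhoods and setwise limits *)

Lemma weakly_open_phi phi c e : ba_dual A phi ->
  weakly_open A (fun nu => Rabs (phi nu - c) < e).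
Proof.
  intros Hphi mu Hmu H. exists [phi], (e - Rabs (phi mu - c)). split; [lra|]. split; auto.
  intros nu Hnu Hc. inversion_clear Hc. replace (phi nu - c) with ((phi nu - phi mu) + (phi mu - c)) by ring.
  eapply Rle_lt_trans; [apply Rabs_triang|]. lra.
Qed.

Lemma weakly_open_inter (U V : ((Omega -> Prop) -> R) -> Prop) :
  weakly_open A U -> weakly_open A V -> weakly_open A (fun nu => U nu /\ V nu).
Proof.
  intros HU HV mu Hmu [Um Vm].
  destruct (HU mu Hmu Um) as [l1 [e1 [He1 [Hl1 H1]]]].
  destruct (HV mu Hmu Vm) as [l2 [e2 [He2 [Hl2 H2]]]].
  exists (l1 ++ l2), (Rmin e1 e2). split; [now apply Rmin_glb_lt|].
  split; [now apply Forall_app|]. intros nu Hnu Hf. apply Forall_app in Hf. destruct Hf as [F1 F2].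
  split; [apply H1|apply H2]; auto; eapply Forall_impl; try eassumption; cbv beta; intros phi Hp;
    eapply Rlt_le_trans; try exact Hp; [apply Rmin_l|apply Rmin_r].
Qed.

Lemma weakly_open_basic phis mu e : Forall (ba_dual A) phis ->
  weakly_open A (fun nu => Forall (fun phi => Rabs (phi nu - phi mu) < e) phis).
Proof.
  induction 1 as [|phi l Hphi Hl IH].
  - intros nu _ _. exists nil, 1. split; [lra|]. split; auto.
  - assert (H := weakly_open_inter _ _ (weakly_open_phi phi (phi mu) e Hphi) IH).
    intros nu Hnu Hf. inversion_clear Hf.
    destruct (H nu Hnu (conj H0 H1)) as [l' [e' [He' [Hl' H']]]].
    exists l', e'. split; auto. split; auto. intros nu' Hnu' Hc.
    destruct (H' nu' Hnu' Hc). now constructor.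
Qed.

Lemma weak_closure_approx M mu phis e : weak_closure A M mu -> Forall (ba_dual A) phis -> 0 < e ->
  exists nu, M nu /\ Forall (fun phi => Rabs (phi nu - phi mu) < e) phis.
Proof.
  intros [_ H] Hp He. apply H.
  - now apply weakly_open_basic.
  - apply Forall_forall. intros phi _. rewrite Rminus_diag, Rabs_R0; auto.
Qed.

Lemma dual_le_eval E : A E -> dual_le 1 (fun nu => nu E).
Proof.
  intros HE. split; [auto|]. intros nu Hnu. rewrite Rmult_1_l.
  eapply Rle_trans; [now apply abs_le_tv|].
  apply pos_add_mono; auto using tv_pos_add, alg_T. intros; exact I.
Qed.

(* Closed under setwise limits: this puts an ultrafilter limit in a set where [dual_approx] applies
   before the limit is known to lie in the weak closure. *)
Definition variation_hull (M : ((Omega -> Prop) -> R) -> Prop) mu : Prop :=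
  fin_additive A mu /\ forall l b, Forall A l -> disjl l ->
    (forall m, M m -> sum_abs m l <= b) -> sum_abs mu l <= b.

Lemma variation_hull_incl (M : ((Omega -> Prop) -> R) -> Prop) mu :
  (forall m, M m -> in_ba A m) -> M mu -> variation_hull M mu.
Proof. intros HM H. split; auto. apply (HM mu H). Qed.

(** Additivity concerns three sets and each variation inequality finitely many, so approximation on
    finite lists of sets is enough. *)
Lemma variation_hull_limit (M S : ((Omega -> Prop) -> R) -> Prop) mu :
  (forall m, S m -> variation_hull M m) ->
  (forall l eta, Forall A l -> 0 < eta ->
     exists m, S m /\ forall E, In E l -> Rabs (m E - mu E) <= eta) ->
  variation_hull M mu.
Proof.
  intros HS Hap. split.
  - intros E F HE HF Hd. apply Rminus_diag_uniq. apply NNPP. intros Hne.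
    set (r := _ - _) in Hne. assert (Hr : 0 < Rabs r) by now apply Rabs_pos_lt.
    destruct (Hap [E; F; fun x => E x \/ F x] (Rabs r / 4)) as [m [Sm Hm]]; [|lra|].
    + repeat constructor; auto using alg_U.
    + assert (Hma := proj1 (HS m Sm) E F HE HF Hd).
      assert (B1 := Hm E ltac:(simpl; auto)). assert (B2 := Hm F ltac:(simpl; auto)).
      assert (B3 := Hm (fun x => E x \/ F x) ltac:(simpl; auto)).
      assert (Rabs r <= 3 * (Rabs r / 4)); [|lra]. apply Rabs_le_inv in B1, B2, B3.
      set (t := Rabs r / 4) in *. clearbody t. apply Rabs_le. unfold r. lra.
  - intros l b Hl Hd Hb. apply Rnot_lt_le. intros Hlt.
    set (n := INR (length l)). assert (Hn : 0 <= n) by apply pos_INR.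
    set (eta := (sum_abs mu l - b) / (n + 1) / 2).
    assert (Heta : 0 < eta) by (unfold eta; repeat apply Rdiv_lt_0_compat; lra).
    assert (Eeta : (n + 1) * eta = (sum_abs mu l - b) / 2) by (unfold eta; field; lra).
    destruct (Hap l eta Hl Heta) as [m [Sm Hm]].
    assert (Hmb := proj2 (HS m Sm) l b Hl Hd Hb).
    assert (B : sum_abs mu l <= lsum (fun E => Rabs (m E) + Rabs (m E - mu E)) l).
    { apply (lsum_le_in (fun E => Rabs (mu E))). intros E _.
      replace (mu E) with (m E - (m E - mu E)) at 1 by ring.
      unfold Rminus at 1. eapply Rle_trans; [apply Rabs_triang|]. rewrite Rabs_Ropp. lra. }
    rewrite lsum_plus in B. change (lsum (fun v => Rabs (m v)) l) with (sum_abs m l) in B.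
    assert (B' := lsum_bound (fun E => Rabs (m E - mu E)) l eta Hm). fold n in B'.
    nra.
Qed.

Lemma variation_hull_bounded (M : ((Omega -> Prop) -> R) -> Prop) C mu :
  (forall m, M m -> in_ba A m /\ ba_norm A m <= C) -> variation_hull M mu ->
  in_ba A mu /\ ba_norm A mu <= C.
Proof.
  intros HM [Ha Hb].
  assert (B : forall l, Forall A l -> disjl l -> sum_abs mu l <= C).
  { intros l Hl Hd. apply Hb; auto. intros m Hm. destruct (HM m Hm).
    eapply Rle_trans; [|eassumption]. apply sum_abs_le_tv; auto using alg_T. intros; exact I. }
  assert (Hi : in_ba A mu).
  { split; auto. exists C. intros l Hl. apply partition_iff in Hl. now apply B. }
  split; auto. apply tv_le; auto using alg_T.
Qed.

(** A bound on the variation over E consists of inequalities on finite families, which the hull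
    inherits; [lam] and [d] are unchanged. *)
Lemma variation_hull_abs_cont (M : ((Omega -> Prop) -> R) -> Prop) C :
  (forall m, M m -> in_ba A m /\ ba_norm A m <= C) -> unif_abs_cont M ->
  unif_abs_cont (variation_hull M).
Proof.
  intros HM Hac eps He. destruct (Hac eps He) as [lam [d [Hl [Hd H]]]].
  exists lam, d. split; auto. split; auto. intros mu Hmu E HE HlE.
  destruct (variation_hull_bounded M C mu HM Hmu) as [Hi _].
  apply tv_le; auto. intros l H1 H2 H3. apply Hmu; auto. intros m Hm.
  eapply Rle_trans; [|apply (H m Hm E HE HlE)]. apply sum_abs_le_tv; auto. now apply HM.
Qed.

(** Evaluations at sets are functionals, so weak approximation by elements of M is in particular
    setwise. *)
Lemma weak_closure_hull (M : ((Omega -> Prop) -> R) -> Prop) mu :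
  (forall m, M m -> in_ba A m) -> weak_closure A M mu -> variation_hull M mu.
Proof.
  intros HM Hmu. apply (variation_hull_limit M M); [intros; now apply variation_hull_incl|].
  intros l eta Hl He.
  destruct (weak_closure_approx M mu (map (fun E nu => nu E) l) eta Hmu) as [m [Hm Hc]]; auto.
  - rewrite Forall_map. eapply Forall_impl; [|exact Hl]. intros E HE.
    apply (dual_le_ba _ 1). now apply dual_le_eval.
  - exists m. split; auto. intros E HE. rewrite Forall_map, Forall_forall in Hc.
    apply Rlt_le, Hc; auto.
Qed.

Lemma integ_setwise_close mu nu s eta : is_simple A s ->
  (forall v, In v (range_list s) -> Rabs (nu (fun x => s x = v) - mu (fun x => s x = v)) <= eta) ->
  Rabs (integ nu s - integ mu s) <= eta * lsum Rabs (range_list s).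
Proof.
  intros Hs H.
  replace (integ nu s - integ mu s) with
    (lsum (fun v => v * (nu (fun x => s x = v) - mu (fun x => s x = v))) (range_list s)).
  - eapply Rle_trans; [apply lsum_abs|]. rewrite <- lsum_scal. apply lsum_le_in. intros v Hv.
    rewrite Rabs_mult, Rmult_comm. apply Rmult_le_compat_r; auto using Rabs_pos.
  - unfold integ. fold (lsum (fun v => v * nu (fun x => s x = v)) (range_list s)).
    change (lsum (fun v => v * (nu (fun x => s x = v) - mu (fun x => s x = v))) (range_list s) =
      lsum (fun v => v * nu (fun x => s x = v)) (range_list s) -
      lsum (fun v => v * mu (fun x => s x = v)) (range_list s)).
    set (l := range_list s). clearbody l. clear H. induction l as [|a l IH]; simpl; [ring|].
    rewrite IH. ring.
Qed.

(** For a cover without finite subcover, the complements of its members within the weak closure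
    generate a proper filter. An ultrafilter above it converges setwise to some mu; once the
    convergence is weak, mu lies in the closure, hence in a member of the cover, which the
    ultrafilter excludes. *)
Lemma rel_weakly_compact_of_abs_cont (M : ((Omega -> Prop) -> R) -> Prop) :
  (forall m, M m -> in_ba A m) -> norm_bounded A M -> unif_abs_cont M -> rel_weakly_compact A M.
Proof.
  intros HM [C0 HC0] Hac I U HUo HUc. apply NNPP. intros Hno.
  (* [C0] may be negative when M is empty. *)
  set (C := Rmax C0 0). assert (HC : 0 <= C) by apply Rmax_r.
  assert (HMC : forall m, M m -> in_ba A m /\ ba_norm A m <= C).
  { intros m Hm. split; auto. eapply Rle_trans; [now apply HC0|apply Rmax_l]. }
  destruct (ultrafilter_extends
    (fun X => exists l, forall mu, weak_closure A M mu -> (forall i, In i l -> ~ U i mu) -> X mu))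
    as [G [GI [GS [G0 [GU GF]]]]].
  - exists nil; auto.
  - intros X Y [l Hl] [l' Hl']. exists (l ++ l'). intros mu Hmu Hi. split.
    + apply Hl; auto. intros i Hin. apply Hi, in_app_iff; auto.
    + apply Hl'; auto. intros i Hin. apply Hi, in_app_iff; auto.
  - intros X Y HXY [l Hl]. exists l; auto.
  - intros [l Hl]. apply Hno. exists l. intros mu Hmu. apply NNPP. intros Hn.
    apply (Hl mu Hmu). intros i Hi Ui. apply Hn; eauto.
  - assert (Gcl : G (weak_closure A M)) by (apply GF; exists nil; auto).
    assert (GUi : forall i, G (fun mu => ~ U i mu)).
    { intros i. apply GF. exists [i]. intros mu _ H. apply H. simpl; auto. }
    assert (Gfin : forall T (l : list T) (X : T -> ((Omega -> Prop) -> R) -> Prop),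
      (forall v, In v l -> G (X v)) -> G (fun nu => forall v, In v l -> X v nu)).
    { intros T l X. induction l as [|a l IH]; intros H.
      - apply (GS (weak_closure A M)); auto. intros nu _ v [].
      - eapply GS; [|exact (GI _ _ (H a (or_introl eq_refl)) (IH (fun v h => H v (or_intror h))))].
        intros nu [H1 H2] v [<-|Hv]; auto. }
    assert (Gne : forall X, G X -> exists nu, X nu).
    { intros X HX. apply NNPP. intros Hn. apply G0. apply (GS X); auto.
      intros nu Xn. apply Hn; eauto. }
    assert (Hcl : forall nu, weak_closure A M nu -> variation_hull M nu)
      by (intros; now apply weak_closure_hull).
    assert (Hclb : forall nu, weak_closure A M nu -> in_ba A nu /\ ba_norm A nu <= C)
      by (intros nu Hnu; apply (variation_hull_bounded M); auto).
    (* Only the values on A are shown to be limits; nothing is claimed off A. *)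
    pose (mu := fun E => epsilon (inhabits 0)
      (fun r => forall e, 0 < e -> G (fun nu => Rabs (nu E - r) <= e))).
    assert (Hmu : forall E, A E -> forall e, 0 < e -> G (fun nu => Rabs (nu E - mu E) <= e)).
    { intros E HE. unfold mu. apply epsilon_spec.
      apply (ultrafilter_limit G GI GS G0 GU (fun nu => nu E) C).
      apply (GS (weak_closure A M)); auto. intros nu Hnu. destruct (Hclb nu Hnu) as [Hi Hn].
      eapply Rle_trans; [apply (proj2 (dual_le_eval E HE) nu Hi)|]. lra. }
    assert (Hmh : variation_hull M mu).
    { apply (variation_hull_limit M (weak_closure A M)); auto. intros l eta Hl He.
      rewrite Forall_forall in Hl.
      destruct (Gne _ (GI _ _ Gcl (Gfin _ l (fun E nu => Rabs (nu E - mu E) <= eta)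
        (fun E HE => Hmu E (Hl E HE) eta He)))) as [nu [H1 H2]]. eauto. }
    destruct (variation_hull_bounded M C mu HMC Hmh) as [Hmi _].
    (* One simple function represents phi up to e/4 on the whole hull, which contains mu and the
       closure. Its integral involves finitely many sets, on which nu is close to mu. *)
    assert (Hphi : forall phi, ba_dual A phi -> forall e, 0 < e ->
      G (fun nu => Rabs (phi nu - phi mu) < e)).
    { intros phi Hphi e He.
      destruct (dual_approx (variation_hull M) C phi (e / 4) HC) as [s [Hs Hsa]]; auto; [..|lra|].
      - intros; now apply (variation_hull_bounded M).
      - now apply variation_hull_abs_cont with C.
      - set (B := lsum Rabs (range_list s)).
        assert (HB : 0 <= B) by (apply lsum_ge0; intros; apply Rabs_pos).
        assert (Heta : 0 < e / 4 / (B + 1)) by (repeat apply Rdiv_lt_0_compat; lra).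
        set (eta := e / 4 / (B + 1)) in *.
        assert (Eeta : eta * (B + 1) = e / 4) by (unfold eta; field; lra).
        eapply GS; [|exact (GI _ _ Gcl (Gfin _ (range_list s)
          (fun v nu => Rabs (nu (fun x => s x = v) - mu (fun x => s x = v)) <= eta)
          (fun v _ => Hmu _ (proj2 Hs v) eta Heta)))].
        intros nu [H1 H2]. assert (B1 := integ_setwise_close mu nu s eta Hs H2). fold B in B1.
        assert (B2 := Hsa mu Hmh). assert (B3 := Hsa nu (Hcl nu H1)).
        apply Rabs_le_inv in B1, B2, B3. apply Rabs_def1; lra. }
    assert (Hopen : forall V, weakly_open A V -> V mu -> G (fun nu => weak_closure A M nu /\ V nu)).
    { intros V HV Vm. destruct (HV mu Hmi Vm) as [phis [e [He [Hp HVe]]]].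
      rewrite Forall_forall in Hp.
      eapply GS; [|exact (GI _ _ Gcl (Gfin _ phis (fun phi nu => Rabs (phi nu - phi mu) < e)
        (fun phi h => Hphi phi (Hp phi h) e He)))].
      intros nu [H1 H2]. split; auto. apply HVe; [apply Hclb; auto|]. now apply Forall_forall. }
    assert (Hmcl : weak_closure A M mu).
    { split; auto. intros V HV Vm. destruct (Gne _ (Hopen V HV Vm)) as [nu [H1 H2]].
      now apply H1. }
    destruct (HUc mu Hmcl) as [i Ui].
    destruct (Gne _ (GI _ _ (GUi i) (Hopen _ (HUo i) Ui))) as [nu [H1 [_ H2]]]. auto.
Qed.

(** * Banach limits and weak cluster points *)

Lemma integ_dist mu f g : in_ba A mu -> is_simple A f -> is_simple A g ->
  Rabs (integ mu f - integ mu g) <= abs_integ A mu (fun x => f x - g x).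
Proof.
  intros Hmu Hf Hg. replace (integ mu f - integ mu g) with (1 * integ mu f + -1 * integ mu g) by ring.
  rewrite <- integ_lin; auto; [|apply Hmu]. unfold abs_integ.
  replace (fun x => Rabs (f x - g x)) with (fun x => Rabs (1 * f x + -1 * g x))
    by (extensionality x; f_equal; ring).
  apply (integ_abs mu (tv A mu)); try apply Hmu; try apply tv_pos_add; auto.
  - intros; now apply abs_le_tv.
  - exact (simple_comp2 (fun a b => 1 * a + -1 * b) f g Hf Hg).
Qed.

Lemma integ_bound mu f C : in_ba A mu -> is_simple A f -> (forall x, Rabs (f x) <= C) ->
  Rabs (integ mu f) <= C * ba_norm A mu.
Proof.
  intros Hmu Hf HC. assert (Hp := tv_pos_add mu Hmu).
  eapply Rle_trans; [apply (integ_abs mu (tv A mu)); auto; try apply Hmu; try apply Hp|].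
  - intros; now apply abs_le_tv.
  - eapply Rle_trans; [apply (integ_le _ _ (fun _ => C)); auto using simple_const|].
    + exact (simple_comp Rabs f Hf).
    + rewrite integ_const; [|apply Hp]. unfold ba_norm; lra.
Qed.

Context (L : (nat -> R) -> R) (hL : banach_limit L).

Lemma bounded_seq_lin a b x y : bounded_seq x -> bounded_seq y ->
  bounded_seq (fun n => a * x n + b * y n).
Proof.
  intros [C HC] [C' HC']. exists (Rabs a * C + Rabs b * C'). intros n.
  eapply Rle_trans; [apply Rabs_triang|]. rewrite !Rabs_mult.
  apply Rplus_le_compat; apply Rmult_le_compat_l; auto using Rabs_pos.
Qed.

Lemma bounded_seq_const c : bounded_seq (fun _ => c).
Proof. exists (Rabs c). intros; lra. Qed.

Lemma blim_lin a b x y : bounded_seq x -> bounded_seq y ->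
  L (fun n => a * x n + b * y n) = a * L x + b * L y.
Proof. apply hL. Qed.

Lemma blim_minus x y : bounded_seq x -> bounded_seq y ->
  L (fun n => x n - y n) = L x - L y.
Proof.
  intros Hx Hy. replace (L x - L y) with (1 * L x + -1 * L y) by ring. rewrite <- blim_lin; auto.
  f_equal. extensionality n. ring.
Qed.

Lemma blim_const c : L (fun _ => c) = c.
Proof.
  assert (H := blim_lin c 0 (fun _ => 1) (fun _ => 1) (bounded_seq_const 1) (bounded_seq_const 1)).
  rewrite (proj2 (proj2 (proj2 hL))) in H. cbv beta in H.
  replace (c * 1 + 0 * 1) with c in H by ring. exact H.
Qed.

Lemma blim_shift x k : bounded_seq x -> L (fun n => x (k + n)%nat) = L x.
Proof.
  intros Hx. induction k as [|k IH]; [reflexivity|]. rewrite <- IH.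
  assert (Hb : bounded_seq (fun n => x (k + n)%nat)) by (destruct Hx as [C HC]; exists C; auto).
  rewrite <- (proj1 (proj2 (proj2 hL)) _ Hb). f_equal. extensionality n. f_equal. lia.
Qed.

(** Shift invariance drops the first N terms, so positivity is needed only eventually. *)
Lemma blim_ge x c N : bounded_seq x -> (forall n, (N <= n)%nat -> c <= x n) -> c <= L x.
Proof.
  intros Hx H. rewrite <- (blim_shift x N Hx).
  assert (Hb : bounded_seq (fun n => x (N + n)%nat)) by (destruct Hx as [C HC]; exists C; auto).
  enough (0 <= L (fun n => x (N + n)%nat - c)).
  { rewrite (blim_minus _ (fun _ => c)), blim_const in H0; auto using bounded_seq_const. lra. }
  apply hL.
  - assert (H1 := bounded_seq_lin 1 (-1) _ _ Hb (bounded_seq_const c)). cbv beta in H1.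
    destruct H1 as [C HC]. exists C. intros n. specialize (HC n).
    replace (x (N + n)%nat - c) with (1 * x (N + n)%nat + -1 * c) by ring. auto.
  - intros n. assert (H1 := H (N + n)%nat). assert (c <= x (N + n)%nat) by (apply H1; lia). lra.
Qed.

Lemma blim_near x s c N : bounded_seq x -> (forall n, (N <= n)%nat -> Rabs (x n - s) <= c) ->
  Rabs (L x - s) <= c.
Proof.
  intros Hx H. apply Rabs_le. split.
  - enough (s - c <= L x) by lra. apply (blim_ge x _ N); auto. intros n Hn.
    specialize (H n Hn). apply Rabs_le_inv in H. lra.
  - enough (- s - c <= -1 * L x + 0 * L x) by lra. rewrite <- blim_lin; auto.
    apply (blim_ge _ _ N); auto using bounded_seq_lin. intros n Hn.
    specialize (H n Hn). apply Rabs_le_inv in H. lra.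
Qed.

Lemma blim_abs_le x c N : bounded_seq x -> (forall n, (N <= n)%nat -> Rabs (x n) <= c) ->
  Rabs (L x) <= c.
Proof.
  intros Hx H. rewrite <- (Rminus_0_r (L x)). apply (blim_near x 0 c N); auto.
  intros n Hn. rewrite Rminus_0_r. auto.
Qed.

Lemma blim_lsum {T} (c : T -> R) (x : T -> nat -> R) l : (forall v, In v l -> bounded_seq (x v)) ->
  bounded_seq (fun n => lsum (fun v => c v * x v n) l) /\
  L (fun n => lsum (fun v => c v * x v n) l) = lsum (fun v => c v * L (x v)) l.
Proof.
  induction l as [|a l IH]; intros H; simpl.
  - split; [apply bounded_seq_const|apply blim_const].
  - destruct IH as [H1 H2]; [intros; apply H; simpl; auto|].
    assert (Ha : bounded_seq (x a)) by (apply H; simpl; auto).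
    replace (fun n => c a * x a n + lsum (fun v => c v * x v n) l) with
      (fun n => c a * x a n + 1 * lsum (fun v => c v * x v n) l) by (extensionality n; ring).
    split; [now apply bounded_seq_lin|]. rewrite blim_lin, H2; auto. ring.
Qed.

(** Source of functionals that are not finite combinations of evaluations: [L] applied pointwise
    keeps linearity and the constant. *)
Lemma dual_le_blim (psi : nat -> ((Omega -> Prop) -> R) -> R) K :
  (forall n, dual_le K (psi n)) -> dual_le K (fun nu => L (fun n => psi n nu)).
Proof.
  intros H.
  assert (Hb : forall nu, in_ba A nu -> bounded_seq (fun n => psi n nu)).
  { intros nu Hnu. exists (K * ba_norm A nu). intros n. now apply H. }
  split.
  - intros a b nu nu' Hn Hn'. rewrite <- blim_lin; auto. f_equal. extensionality n. now apply H.
  - intros nu Hnu. apply (blim_abs_le _ _ 0); auto. intros n _. now apply H.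
Qed.

Lemma dual_le_lsum {T} (c : T -> R) (psi : T -> ((Omega -> Prop) -> R) -> R) K K' l :
  (forall v, In v l -> dual_le K' (psi v)) ->
  (forall nu, in_ba A nu -> Rabs (lsum (fun v => c v * psi v nu) l) <= K * ba_norm A nu) ->
  dual_le K (fun nu => lsum (fun v => c v * psi v nu) l).
Proof.
  intros H HK. split; auto. intros a b nu nu' Hn Hn'. rewrite <- lsum_lin.
  apply lsum_ext_in. intros v Hv. rewrite (proj1 (H v Hv)); auto. ring.
Qed.

Lemma finite_eventually {T} (P : T -> nat -> Prop) l :
  (forall v, In v l -> exists N, forall n, (N <= n)%nat -> P v n) ->
  exists N, forall n, (N <= n)%nat -> forall v, In v l -> P v n.
Proof.
  induction l as [|a l IH]; intros H.
  - exists 0%nat. intros n _ v [].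
  - destruct IH as [N HN]; [intros; apply H; simpl; auto|].
    destruct (H a) as [N' HN']; [simpl; auto|]. exists (N + N')%nat.
    intros n Hn v [<-|Hv]; [apply HN'; lia|apply HN; auto; lia].
Qed.

(** If each point of the closure had a weak neighbourhood that the sequence eventually avoids,
    finitely many of these would cover the closure, and a late term would lie in none. The cluster
    point stands in for the weakly convergent subsequence of the Eberlein-Smulian theorem. *)
Lemma weak_cluster_point (M : ((Omega -> Prop) -> R) -> Prop) (mu : nat -> (Omega -> Prop) -> R) :
  (forall m, M m -> in_ba A m) -> rel_weakly_compact A M -> (forall k, M (mu k)) ->
  exists nu, in_ba A nu /\ forall phis e N, Forall (ba_dual A) phis -> 0 < e ->
    exists k, (N <= k)%nat /\ Forall (fun phi => Rabs (phi (mu k) - phi nu) < e) phis.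
Proof.
  intros HM Hc Hmu. apply NNPP. intros Hno.
  destruct (Hc {U | weakly_open A U /\ exists N, forall k, (N <= k)%nat -> ~ U (mu k)}
    (fun i => proj1_sig i)) as [l Hl].
  - intros [U HU]. apply HU.
  - intros nu Hnu. apply NNPP. intros Hn. apply Hno. exists nu. split; [apply Hnu|].
    intros phis e N Hp He. apply NNPP. intros Hk. apply Hn.
    unshelve eexists (exist _ (fun nu' => Forall (fun phi => Rabs (phi nu' - phi nu) < e) phis) _).
    + split; [now apply weakly_open_basic|]. exists N. intros k HNk HF. apply Hk; eauto.
    + simpl. apply Forall_forall. intros phi _. rewrite Rminus_diag, Rabs_R0; auto.
  - destruct (finite_eventually (fun i k => ~ proj1_sig i (mu k)) l) as [N HN].
    + intros [U HU] _. apply HU.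
    + destruct (Hl (mu N)) as [i [Hi Ui]].
      * split; [now apply HM|]. intros U _ Um. exists (mu N). auto.
      * exact (HN N (le_n _) i Hi Ui).
Qed.

Lemma lsum_geom r s n : 0 < r -> r < 1 -> lsum (fun k => r ^ k) (seq s n) <= r ^ s / (1 - r).
Proof.
  intros H0 H1. revert s. induction n as [|n IH]; intros s; simpl.
  - apply Rlt_le, Rdiv_lt_0_compat; [now apply pow_lt|lra].
  - specialize (IH (S s)). simpl in IH.
    replace (r ^ s / (1 - r)) with (r ^ s + r * r ^ s / (1 - r)) by (field; lra). lra.
Qed.

(** * Consequences of weak compactness *)

(* Gliding hump: signed sets [G n] with weights [5^-n] give a functional unbounded on [M]. *)
Lemma rel_weakly_compact_bounded (M : ((Omega -> Prop) -> R) -> Prop) :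
  (forall m, M m -> in_ba A m) -> rel_weakly_compact A M -> norm_bounded A M.
Proof.
  intros HM Hc. apply NNPP. intros Hno.
  assert (Hpow : forall n, 0 < (/5) ^ n) by (intros; apply pow_lt; lra).
  destruct (dependent_choice_list (X := (R * (Omega -> Prop)) * ((Omega -> Prop) -> R))
    (fun w => M (snd w) /\ A (snd (fst w)))
    (* [tv_set] yields any share of the norm below 1/2; 3/8 is taken. Later terms of the series
       weigh at most 5^-n / 4 times the norm, which leaves 5^-n / 8 times the norm, required to be
       at least n. *)
    (fun l w => Rabs (fst (fst w)) = (/5) ^ (length l) /\
       INR (length l) <= (/5) ^ (length l) * ba_norm A (snd w) / 8 /\
       (/5) ^ (length l) * (3 / 8 * ba_norm A (snd w)) <=
       Rabs (lsum (fun v => fst (fst v) * snd w (snd (fst v))) l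
         + fst (fst w) * snd w (snd (fst w))))) as [u Hu].
  - intros l _. set (n := length l). assert (Hn := Hpow n). set (a := (/5) ^ n) in *.
    assert (Hex : exists mu, M mu /\ (INR n + 1) * 8 / a < ba_norm A mu).
    { apply NNPP. intros Hn'. apply Hno. exists ((INR n + 1) * 8 / a). intros mu Hmu.
      apply Rnot_lt_le. intros Hlt. apply Hn'; eauto. }
    destruct Hex as [mu [Hmu Hbig]].
    assert (Hbig' : (INR n + 1) * 8 < a * ba_norm A mu).
    { apply (Rmult_lt_compat_l a) in Hbig; auto.
      replace (a * ((INR n + 1) * 8 / a)) with ((INR n + 1) * 8) in Hbig by (field; lra). lra. }
    assert (Hn0 := pos_INR n).
    assert (Hpos : 0 < ba_norm A mu) by (apply (Rmult_lt_reg_l a); lra).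
    destruct (tv_set mu setT (3 / 8 * ba_norm A mu)) as [G [AG [_ HG]]]; auto using alg_T.
    { unfold ba_norm in *. lra. }
    set (t := lsum (fun v => fst (fst v) * mu (snd (fst v))) l).
    (* One of |t + a mu(G)| and |t - a mu(G)| is at least |a mu(G)|, so a sign exists for which the
       earlier terms do not cancel the new one. *)
    assert (Hc' : exists c, Rabs c = a /\ a * Rabs (mu G) <= Rabs (t + c * mu G)).
    { assert (Ha : a * Rabs (mu G) = Rabs (a * mu G)) by (rewrite Rabs_mult, (Rabs_right a); lra).
      destruct (Rle_dec (Rabs (a * mu G)) (Rabs (t + a * mu G))).
      - exists a. rewrite Rabs_right; lra.
      - exists (- a). rewrite Rabs_Ropp, Rabs_right, Ha by lra. split; auto.
        unfold Rabs in *. repeat destruct Rcase_abs; lra. }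
    destruct Hc' as [c [Hc1 Hc2]]. exists (c, G, mu). simpl. fold t.
    split; auto. split; auto. split; [lra|].
    eapply Rle_trans; [|exact Hc2]. apply Rmult_le_compat_l; lra.
  - pose (c := fun n => fst (fst (u n))). pose (G := fun n => snd (fst (u n))).
    pose (m := fun n => snd (u n)).
    assert (Hu' : forall n, Rabs (c n) = (/5) ^ n /\ INR n <= (/5) ^ n * ba_norm A (m n) / 8 /\
      (/5) ^ n * (3 / 8 * ba_norm A (m n)) <= Rabs (lsum (fun k => c k * m n (G k)) (seq 0 (S n)))).
    { intros n. destruct (Hu n) as [_ H]. rewrite length_map, length_seq, lsum_map in H.
      rewrite seq_S, lsum_app. simpl. rewrite Rplus_0_r. exact H. }
    assert (Mm : forall n, M (m n)) by (intros; apply Hu).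
    assert (AG : forall n, A (G n)) by (intros; apply Hu).
    assert (Hsum : forall nu s n, in_ba A nu ->
      Rabs (lsum (fun k => c k * nu (G k)) (seq s n)) <= (/5) ^ s * (5 / 4) * ba_norm A nu).
    { intros nu s n Hnu. eapply Rle_trans; [apply lsum_abs|].
      apply Rle_trans with (lsum (fun k => ba_norm A nu * (/5) ^ k) (seq s n)).
      - apply lsum_le_in. intros k _. rewrite Rabs_mult, (proj1 (Hu' k)), Rmult_comm.
        apply Rmult_le_compat_r; [apply Rlt_le, Hpow|].
        assert (B := proj2 (dual_le_eval (G k) (AG k)) nu Hnu). lra.
      - rewrite lsum_scal, Rmult_comm. apply Rmult_le_compat_r; [now apply ba_norm_ge0|].
        eapply Rle_trans; [apply lsum_geom; lra|]. apply Req_le. field. }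
    (* [L] of the partial sums stands for the sum of the series and lies in the dual by
       [dual_le_blim]; 5/4 is the sum of the weights. *)
    pose (phi := fun nu => L (fun n => lsum (fun k => c k * nu (G k)) (seq 0 n))).
    assert (Hphi : dual_le (5 / 4) phi).
    { apply (dual_le_blim (fun n nu => lsum (fun k => c k * nu (G k)) (seq 0 n))). intros n.
      apply (dual_le_lsum c (fun k nu => nu (G k)) _ 1).
      - intros; now apply dual_le_eval.
      - intros nu Hnu. eapply Rle_trans; [now apply Hsum|]. simpl. lra. }
    assert (Hbig : forall n, INR n <= Rabs (phi (m n))).
    { intros n. destruct (Hu' n) as [_ [H1 H2]]. assert (Hb := HM _ (Mm n)).
      set (t := lsum _ _) in H2.
      assert (Rabs (phi (m n) - t) <= (/5) ^ n * / 4 * ba_norm A (m n)).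
      { apply (blim_near _ _ _ (S n)).
        - exists (5 / 4 * ba_norm A (m n)). intros k. eapply Rle_trans; [now apply Hsum|]. simpl. lra.
        - intros k Hk. replace k with (S n + (k - S n))%nat by lia.
          rewrite seq_app, lsum_app. fold t.
          replace (t + _ - t) with (lsum (fun k => c k * m n (G k)) (seq (0 + S n) (k - S n))) by ring.
          eapply Rle_trans; [now apply Hsum|]. simpl. apply Req_le. field. }
      unfold Rabs in *. repeat destruct Rcase_abs; lra. }
    (* For some k beyond any bound, [phi (m k)] is within 1 of [phi nu], whereas its absolute value
       is at least k. *)
    destruct (weak_cluster_point M m HM Hc Mm) as [nu [Hnu Hcl]].
    destruct (INR_unbounded (Rabs (phi nu) + 1)) as [N HN].
    destruct (Hcl [phi] 1 N) as [k [Hk HF]]; [constructor; auto; eapply dual_le_ba; eauto|lra|].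
    inversion_clear HF. specialize (Hbig k). apply le_INR in Hk.
    assert (B := Rabs_triang (phi (m k) - phi nu) (phi nu)).
    replace (phi (m k) - phi nu + phi nu) with (phi (m k)) in B by ring. lra.
Qed.

(** Take a list whose sum comes within e of the supremum: indices beyond its largest one add at most
    e. Lists without repetition, rather than initial segments, allow sums over subsequences. *)
Lemma abs_summable_tail {T} (f : nat -> T -> R) (t : T) C e : 0 < e ->
  (forall l, NoDup l -> lsum (fun k => Rabs (f k t)) l <= C) ->
  exists N, forall l, NoDup l -> (forall k, In k l -> (N <= k)%nat) ->
    lsum (fun k => Rabs (f k t)) l <= e.
Proof.
  intros He HC. set (F := lsum (fun k => Rabs (f k t))) in *.
  destruct (completeness (fun r => exists l, NoDup l /\ r = F l)) as [s [Hs1 Hs2]].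
  - exists C. intros r [l [Hl ->]]. auto.
  - exists (F nil). exists nil. split; auto. constructor.
  - assert (Hex : exists l, NoDup l /\ s - e < F l).
    { apply NNPP. intros Hn. assert (s <= s - e); [|lra]. apply Hs2. intros r [l [Hl ->]].
      apply Rnot_lt_le. intros Hlt. apply Hn; eauto. }
    destruct Hex as [l0 [Hl0 Hb]]. exists (S (list_max l0)). intros l Hl Hk.
    assert (Hd : F (l0 ++ l) <= s).
    { apply Hs1. exists (l0 ++ l). split; auto. apply NoDup_app; auto.
      intros k Hk0 Hkl. specialize (Hk k Hkl).
      assert (Hm := proj1 (list_max_le l0 (list_max l0)) (le_n _)).
      rewrite Forall_forall in Hm. specialize (Hm k Hk0). lia. }
    unfold F in Hd. rewrite lsum_app in Hd. fold F in Hd. lra.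
Qed.

Lemma seq_split_at s n i : (s <= i)%nat -> (i < s + n)%nat ->
  seq s n = seq s (i - s) ++ i :: seq (S i) (s + n - S i).
Proof.
  intros H1 H2. replace n with ((i - s) + S (s + n - S i))%nat at 1 by lia.
  rewrite seq_app. f_equal. replace (s + (i - s))%nat with i by lia. reflexivity.
Qed.

(* The map [nu |-> (x_k nu)_k] sends [M] to a relatively weakly compact subset of l^1, where the
   diagonal must vanish. Two cluster points are used: coordinatewise closeness to the first
   makes the matrix almost diagonal along a subsequence, and the second contradicts it. *)
Lemma rel_weakly_compact_diagonal (M : ((Omega -> Prop) -> R) -> Prop)
    (x : nat -> ((Omega -> Prop) -> R) -> R) (mu : nat -> (Omega -> Prop) -> R) d :
  (forall m, M m -> in_ba A m) -> rel_weakly_compact A M -> (forall k, M (mu k)) ->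
  (forall k, dual_le 1 (x k)) ->
  (forall nu l, in_ba A nu -> NoDup l -> lsum (fun k => Rabs (x k nu)) l <= ba_norm A nu) ->
  0 < d -> (forall k, d <= Rabs (x k (mu k))) -> False.
Proof.
  intros HM Hc Hmu Hx Hxs Hd Hdiag.
  destruct (weak_cluster_point M mu HM Hc Hmu) as [nu [Hnu Hcl]].
  assert (Htail : forall nu', in_ba A nu' -> forall e, 0 < e -> exists N, forall l, NoDup l ->
    (forall k, In k l -> (N <= k)%nat) -> lsum (fun k => Rabs (x k nu')) l <= e).
  { intros nu' Hnu' e He. apply (abs_summable_tail x nu' (ba_norm A nu')); auto. }
  (* Past [K0], |x_k(nu)| is at most d/2, so at least d/2 of the diagonal survives centring at
     nu. *)
  destruct (Htail nu Hnu (d / 2)) as [K0 HK0]; [lra|].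
  pose (y := fun k j => Rabs (x j (mu k) - x j nu)).
  assert (Hytail : forall k, exists N, forall n, (N <= n)%nat -> forall l, NoDup l ->
    (forall j, In j l -> (n <= j)%nat) -> lsum (y k) l <= d / 8).
  { intros k. destruct (Htail nu Hnu (d / 16)) as [N1 H1]; [lra|].
    destruct (Htail (mu k) (HM _ (Hmu k)) (d / 16)) as [N2 H2]; [lra|].
    exists (N1 + N2)%nat. intros n Hn l Hl Hj.
    apply Rle_trans with (lsum (fun j => Rabs (x j (mu k)) + Rabs (x j nu)) l).
    - apply lsum_le_in. intros j _. unfold y, Rminus. eapply Rle_trans; [apply Rabs_triang|].
      rewrite Rabs_Ropp. lra.
    - rewrite lsum_plus. assert (B1 := H1 l Hl). assert (B2 := H2 l Hl).
      enough (lsum (fun j => Rabs (x j nu)) l <= d / 16 /\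
        lsum (fun j => Rabs (x j (mu k))) l <= d / 16) by lra.
      split; [apply B1|apply B2]; intros j Hjl; specialize (Hj j Hjl); lia. }
  (* In row k_i of [y], the selected columns before and after the diagonal each sum to at most d/8:
     the earlier ones because mu_(k_i) is weakly close to nu on them, the later ones because k_(i+1)
     lies beyond the tail index of the row. *)
  destruct (dependent_choice_list (fun k => (K0 <= k)%nat)
    (fun l k => (forall k', In k' l -> (k' < k)%nat /\ forall l', NoDup l' ->
        (forall j, In j l' -> (k <= j)%nat) -> lsum (y k') l' <= d / 8) /\
      lsum (y k) l <= d / 8)) as [ks Hks].
  { intros l _.
    destruct (finite_eventually (fun k' k => (k' < k)%nat /\ forall l', NoDup l' ->
        (forall j, In j l' -> (k <= j)%nat) -> lsum (y k') l' <= d / 8) l) as [N HN].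
    { intros k' _. destruct (Hytail k') as [N HN]. exists (N + S k')%nat. intros n Hn.
      split; [lia|]. apply HN. lia. }
    set (e := d / 8 / (INR (length l) + 1)). assert (Hl := pos_INR (length l)).
    assert (He : 0 < e) by (unfold e; repeat apply Rdiv_lt_0_compat; lra).
    assert (Ee : (INR (length l) + 1) * e = d / 8) by (unfold e; field; lra).
    destruct (Hcl (map x l) e (N + K0)%nat) as [k [Hk HF]]; auto.
    { rewrite Forall_map. apply Forall_forall. intros j _. exact (dual_le_ba _ _ (Hx j)). }
    exists k. split; [lia|]. split; [apply HN; lia|].
    rewrite Forall_map, Forall_forall in HF.
    eapply Rle_trans; [apply (lsum_bound (y k) l e)|lra].
    intros j Hj. apply Rlt_le, HF; auto. }
  assert (Hlt : forall i j, (i < j)%nat -> (ks i < ks j)%nat).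
  { intros i j Hij. apply (proj1 (proj2 (Hks j))). apply in_map, in_seq. lia. }
  assert (Hge : forall i, (i <= ks i)%nat).
  { induction i as [|i IH]; [lia|]. specialize (Hlt i (S i)). lia. }
  assert (Hnd : forall l, NoDup l -> NoDup (map ks l)).
  { intros l Hl. apply NoDup_map_NoDup_ForallPairs; auto. intros i j _ _ E.
    destruct (Nat.lt_trichotomy i j) as [H|[H|H]]; auto; specialize (Hlt _ _ H); lia. }
  pose (z := fun i => x (ks i)). pose (w := fun i => mu (ks i)).
  pose (sg := fun i => if Rle_dec 0 (z i (w i) - z i nu) then 1 else -1).
  assert (Hsg : forall i, Rabs (sg i) = 1).
  { intros i. unfold sg. destruct Rle_dec; [apply Rabs_R1|]. rewrite Rabs_left; lra. }
  assert (Hsgd : forall i, d / 2 <= sg i * (z i (w i) - z i nu)).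
  { intros i. assert (B1 := Hdiag (ks i)).
    assert (B2 : lsum (fun k => Rabs (x k nu)) [ks i] <= d / 2).
    { apply HK0; [repeat constructor; simpl; tauto|]. intros k [<-|[]]. apply Hks. }
    simpl in B2. assert (B3 := Rabs_triang (z i (w i) - z i nu) (z i nu)).
    replace (z i (w i) - z i nu + z i nu) with (z i (w i)) in B3 by ring.
    unfold z, w in *. unfold sg. destruct Rle_dec as [H|H].
    - rewrite (Rabs_right (_ - _)) in B3 by lra. unfold z, w in *. lra.
    - unfold z, w in H. rewrite (Rabs_left (_ - _)) in B3 by lra. unfold z, w. lra. }
  (* The signs make the centred diagonal terms positive. Tails of the series are used because at any
     fixed measure they become small as n grows, while on the differences of [w i] and [nu] with i
     >= n they keep the diagonal term. *)
  pose (phi := fun n nu' => L (fun m => lsum (fun i => sg i * z i nu') (seq n m))).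
  assert (Hzb : forall nu' l, lsum (fun i => Rabs (sg i * z i nu')) l =
    lsum (fun k => Rabs (x k nu')) (map ks l)).
  { intros nu' l. rewrite lsum_map. apply lsum_ext_in. intros i _.
    rewrite Rabs_mult, Hsg. unfold z. ring. }
  assert (Hzn : forall nu' n m, in_ba A nu' ->
    Rabs (lsum (fun i => sg i * z i nu') (seq n m)) <= ba_norm A nu').
  { intros nu' n m Hnu'. eapply Rle_trans; [apply lsum_abs|cbv beta]. rewrite Hzb.
    apply Hxs; auto. apply Hnd, seq_NoDup. }
  assert (Hphi : forall n, dual_le 1 (phi n)).
  { intros n. apply (dual_le_blim (fun m nu' => lsum (fun i => sg i * z i nu') (seq n m))).
    intros m. apply (dual_le_lsum sg z 1 1).
    - intros v _. apply Hx.
    - intros nu' Hnu'. rewrite Rmult_1_l. auto. }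
  assert (Hbs : forall nu' n, in_ba A nu' ->
    bounded_seq (fun m => lsum (fun i => sg i * z i nu') (seq n m))).
  { intros nu' n Hnu'. exists (ba_norm A nu'). auto. }
  assert (Hwb : forall i, in_ba A (w i)) by (intros i; apply HM, Hmu).
  assert (Hlow : forall n i, (n <= i)%nat -> d / 4 <= phi n (w i) - phi n nu).
  { intros n i Hi. unfold phi. rewrite <- blim_minus; auto.
    apply (blim_ge _ _ (S (i - n))).
    - assert (H := bounded_seq_lin 1 (-1) _ _ (Hbs _ n (Hwb i)) (Hbs _ n Hnu)).
      destruct H as [C HC]. exists C. intros m. specialize (HC m). cbv beta in HC.
      replace (_ - _) with (1 * lsum (fun j => sg j * z j (w i)) (seq n m) +
        -1 * lsum (fun j => sg j * z j nu) (seq n m)) by ring. exact HC.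
    - intros m Hm.
      pose (g := fun j => sg j * (z j (w i) - z j nu)).
      assert (Eg : forall l, lsum (fun j => sg j * z j (w i)) l - lsum (fun j => sg j * z j nu) l
        = lsum g l).
      { intros l. replace (_ - _) with (1 * lsum (fun j => sg j * z j (w i)) l +
          -1 * lsum (fun j => sg j * z j nu) l) by ring.
        rewrite <- lsum_lin. apply lsum_ext_in. intros j _. unfold g. ring. }
      assert (Hg : forall l, Rabs (lsum g l) <= lsum (y (ks i)) (map ks l)).
      { intros l. eapply Rle_trans; [apply lsum_abs|]. rewrite lsum_map. apply Req_le, lsum_ext_in.
        intros j _. unfold g. rewrite Rabs_mult, Hsg. unfold y, z, w. ring. }
      rewrite Eg, (seq_split_at n m i) by lia. rewrite lsum_app. simpl.
      assert (B1 := Hsgd i). fold (g i) in B1.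
      assert (B2 := Hg (seq n (i - n))). assert (B3 := Hg (seq (S i) (n + m - S i))).
      assert (B2' : lsum (y (ks i)) (map ks (seq n (i - n))) <= d / 8).
      { eapply Rle_trans; [|apply (proj2 (proj2 (Hks i)))].
        assert (Es : seq 0 i = seq 0 n ++ seq n (i - n)).
        { replace i with (n + (i - n))%nat at 1 by lia. apply seq_app. }
        rewrite Es, map_app, lsum_app.
        assert (0 <= lsum (y (ks i)) (map ks (seq 0 n)))
          by (apply lsum_ge0; intros; apply Rabs_pos). simpl. lra. }
      assert (B3' : lsum (y (ks i)) (map ks (seq (S i) (n + m - S i))) <= d / 8).
      { apply (proj1 (proj2 (Hks (S i)))).
        - apply in_map, in_seq. lia.
        - apply Hnd, seq_NoDup.
        - intros j Hj. apply in_map_iff in Hj. destruct Hj as [k [<- Hk]]. apply in_seq in Hk.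
          destruct (Nat.eq_dec k (S i)) as [->|Hne]; [lia|].
          assert (ks (S i) < ks k)%nat by (apply Hlt; lia). lia. }
      apply Rabs_le_inv in B2, B3. lra. }
  (* [nu] need not be a cluster point of the subsequence [w]. For large n, [phi n] is at most d/32
     in absolute value at [nu] and at [nu'], and d/8 + d/32 + d/32 < d/4. *)
  destruct (weak_cluster_point M w HM Hc (fun i => Hmu (ks i))) as [nu' [Hnu' Hcl']].
  assert (Hphi_tail : forall nu0, in_ba A nu0 -> exists N, forall n, (N <= n)%nat ->
    Rabs (phi n nu0) <= d / 32).
  { intros nu0 Hnu0. destruct (Htail nu0 Hnu0 (d / 32)) as [N HN]; [lra|].
    exists N. intros n Hn. apply (blim_abs_le _ _ 0); auto. intros m _.
    eapply Rle_trans; [apply lsum_abs|cbv beta]. rewrite Hzb. apply HN; [apply Hnd, seq_NoDup|].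
    intros k Hk. apply in_map_iff in Hk. destruct Hk as [j [<- Hj]]. apply in_seq in Hj.
    specialize (Hge j). lia. }
  destruct (Hphi_tail nu Hnu) as [N1 H1]. destruct (Hphi_tail nu' Hnu') as [N2 H2].
  set (n := (N1 + N2)%nat). specialize (H1 n ltac:(lia)). specialize (H2 n ltac:(lia)).
  destruct (Hcl' [phi n] (d / 8) n) as [i [Hi HF]];
    [constructor; auto; eapply dual_le_ba; eauto|lra|].
  inversion_clear HF. specialize (Hlow n i Hi).
  apply Rabs_def2 in H. apply Rabs_le_inv in H1, H2. lra.
Qed.

Lemma pos_add_bigU m l : pos_add m -> Forall A l -> m (bigU l) <= lsum m l.
Proof.
  intros Hm. induction 1 as [|E l HE Hl IH].
  - simpl. apply Req_le, add_empty; [apply Hm|]. intros x Hx. apply bigU_In in Hx.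
    now destruct Hx as [F [[] _]].
  - assert (AU := alg_bigU l Hl). simpl. rewrite bigU_cons.
    replace (fun x => E x \/ bigU l x) with (fun x => E x \/ (bigU l x /\ ~ E x)).
    + rewrite (proj1 Hm); auto using alg_D; [|intros x; tauto].
      assert (m (fun x => bigU l x /\ ~ E x) <= m (bigU l)); [|lra].
      apply pos_add_mono; auto using alg_D. tauto.
    + apply set_ext; intros x; tauto.
Qed.

(* Disjointification inside the algebra: the sets [G k \ U_(k<j<=N) H j] decrease with [N]; their
   limits need not exist as sets, but define functionals on ba via [L]. *)
Lemma rel_weakly_compact_no_hump (M : ((Omega -> Prop) -> R) -> Prop)
    (mu : nat -> (Omega -> Prop) -> R) (H : nat -> Omega -> Prop) d :
  (forall m, M m -> in_ba A m) -> rel_weakly_compact A M -> (forall k, M (mu k)) ->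
  (forall k, A (H k)) -> 0 < d -> (forall k, d < tv A (mu k) (H k)) ->
  (forall i j, (i < j)%nat -> tv A (mu i) (H j) <= d / 8 * (/2) ^ j) -> False.
Proof.
  intros HM Hc Hmu AH Hd Hbig Hsmall.
  assert (Hb : forall k, in_ba A (mu k)) by auto.
  assert (HG : forall k, exists G, A G /\ (forall x, G x -> H k x) /\ d / 2 < Rabs (mu k G)).
  { intros k. apply tv_set; auto. specialize (Hbig k). lra. }
  pose (G := fun k => proj1_sig (constructive_indefinite_description _ (HG k))).
  assert (HG' : forall k, A (G k) /\ (forall x, G k x -> H k x) /\ d / 2 < Rabs (mu k (G k))).
  { intros k. unfold G. now destruct constructive_indefinite_description. }
  (* The indices run over k < j <= N; for [N <= k] truncated subtraction gives the empty union. *)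
  pose (U := fun k N => bigU (map H (seq (S k) (N - k)))).
  assert (AUl : forall k N, Forall A (map H (seq (S k) (N - k)))).
  { intros k N. rewrite Forall_map. apply Forall_forall. auto. }
  assert (AU : forall k N, A (U k N)) by (intros; apply alg_bigU; auto).
  pose (D := fun N k x => G k x /\ ~ U k N x).
  assert (AD : forall N k, A (D N k)) by (intros; apply alg_D; [apply HG'|apply AU]).
  pose (x := fun k nu => L (fun N => nu (D N k))).
  assert (Hx : forall k, dual_le 1 (x k)).
  { intros k. apply (dual_le_blim (fun N nu => nu (D N k))). intros N. now apply dual_le_eval. }
  assert (Hbs : forall nu k, in_ba A nu -> bounded_seq (fun N => nu (D N k))).
  { intros nu k Hnu. exists (1 * ba_norm A nu). intros N. now apply dual_le_eval. }
  apply (rel_weakly_compact_diagonal M x mu (d / 4)); auto; [|lra|].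
  (* The signs [c] turn the sum of absolute values into a single Banach limit. From N = [list_max l]
     on, the sets [D N k] with k in [l] are disjoint, so the terms are at most the norm of nu. *)
  - intros nu l Hnu Hl.
    pose (c := fun k => if Rle_dec 0 (x k nu) then 1 else -1).
    assert (Hcx : forall k, Rabs (x k nu) = c k * L (fun N => nu (D N k))).
    { intros k. fold (x k nu). unfold c. destruct Rle_dec; [rewrite Rabs_right|rewrite Rabs_left]; lra. }
    rewrite (lsum_ext_in _ _ l (fun k _ => Hcx k)).
    destruct (blim_lsum c (fun k N => nu (D N k)) l) as [B1 B2]; [auto|].
    cbv beta in B2. rewrite <- B2. eapply Rle_trans; [apply Rle_abs|].
    apply (blim_abs_le _ _ (list_max l)); auto. intros N HN.
    eapply Rle_trans; [apply lsum_abs|].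
    assert (Hdj : sum_abs nu (map (D N) l) <= ba_norm A nu).
    { apply sum_abs_le_tv; auto using alg_T; [| |intros; exact I].
      - rewrite Forall_map. apply Forall_forall. auto.
      - assert (Hlt : forall i j, In j l -> (i < j)%nat -> forall t, ~ (D N i t /\ D N j t)).
        { intros i j Hj Hij t [[_ Ht1] [Ht2 _]]. apply Ht1. apply bigU_In.
          exists (H j). split; [|now apply HG'].
          apply in_map, in_seq.
          assert (Hm := proj1 (list_max_le l N) HN). rewrite Forall_forall in Hm.
          specialize (Hm j Hj). lia. }
        apply disjl_map_NoDup; auto. intros i j Hi Hj Hne t [H1 H2].
        destruct (Nat.lt_trichotomy i j) as [Hij|[Hij|Hij]]; [|now auto|].
        + exact (Hlt i j Hj Hij t (conj H1 H2)).
        + exact (Hlt j i Hi Hij t (conj H2 H1)). }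
    eapply Rle_trans; [|exact Hdj]. apply Req_le.
    change (sum_abs nu (map (D N) l)) with (lsum (fun E => Rabs (nu E)) (map (D N) l)).
    rewrite lsum_map. apply lsum_ext_in. intros k _. rewrite Rabs_mult.
    replace (Rabs (c k)) with 1; [ring|]. unfold c. destruct Rle_dec;
      [rewrite Rabs_right|rewrite Rabs_left]; lra.
  (* Of |mu_k(G_k)| > d/2, removing the later sets loses at most the sum of (d/8) 2^-j over j > k,
     which is at most d/8. *)
  - intros k. assert (B : Rabs (x k (mu k) - mu k (G k)) <= d / 8).
    { apply (blim_near _ _ _ 0); auto. intros N _. unfold D.
      destruct (HG' k) as [AG _].
      rewrite (add_split (mu k) (G k) (U k N)); auto; [|apply Hb].
      replace (_ - _) with (- mu k (fun t => G k t /\ U k N t)) by ring. rewrite Rabs_Ropp.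
      eapply Rle_trans; [apply abs_le_tv; auto using alg_I|].
      assert (Hp := tv_pos_add _ (Hb k)).
      eapply Rle_trans; [apply (pos_add_mono _ _ (U k N)); auto using alg_I; tauto|].
      eapply Rle_trans; [apply pos_add_bigU; auto|]. rewrite lsum_map.
      eapply Rle_trans; [apply (lsum_le_in _ (fun j => d / 8 * (/2) ^ j))|].
      - intros j Hj. apply in_seq in Hj. apply Hsmall. lia.
      - rewrite lsum_scal. assert (B := lsum_geom (/2) (S k) (N - k) ltac:(lra) ltac:(lra)).
        assert (B' : (/2) ^ k <= 1).
        { rewrite <- (pow1 k). apply pow_incr. lra. }
        replace ((/2) ^ S k / (1 - /2)) with ((/2) ^ k) in B by (simpl; field).
        rewrite <- (Rmult_1_r (d / 8)) at 2. apply Rmult_le_compat_l; [lra|]. exact (Rle_trans _ _ _ B B'). }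
    destruct (HG' k) as [_ [_ B']]. unfold Rabs in *. repeat destruct Rcase_abs; lra.
Qed.

(** * Level sets, and the uniform Cauchy property from weak compactness *)

Lemma chebyshev m g eta : pos_add m -> is_simple A g ->
  A (fun x => Rabs (g x) > eta) /\
  eta * m (fun x => Rabs (g x) > eta) <= integ m (fun x => Rabs (g x)).
Proof.
  intros Hm Hg. assert (Hag := simple_comp Rabs g Hg).
  assert (AE := labelling_pred g (fun v => Rabs v > eta) Hg). split; auto.
  set (E := fun x => Rabs (g x) > eta) in *.
  rewrite <- (integ_ind m E); auto; [|apply Hm]. assert (Hi := labelling_ind E AE).
  replace (eta * integ m (ind E)) with (eta * integ m (ind E) + 0 * integ m (ind E)) by ring.
  rewrite <- integ_lin; auto; [|apply Hm]. apply integ_le; auto.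
  - exact (simple_comp (fun t => eta * t + 0 * t) _ Hi).
  - intros x. destruct (classic (E x)) as [Ex|Ex].
    + rewrite ind_1; auto. unfold E in Ex. lra.
    + rewrite ind_0; auto. assert (H := Rabs_pos (g x)). lra.
Qed.

(** Read backwards, this turns a large integral of a bounded function into a large measure of a
    level set. *)
Lemma integ_level_bound m g eta C : pos_add m -> is_simple A g -> 0 <= eta ->
  (forall x, Rabs (g x) <= C) ->
  integ m (fun x => Rabs (g x)) <= C * m (fun x => Rabs (g x) > eta) + eta * m setT.
Proof.
  intros Hm Hg Heta HC. assert (Hag := simple_comp Rabs g Hg).
  assert (AE := labelling_pred g (fun v => Rabs v > eta) Hg).
  set (E := fun x => Rabs (g x) > eta) in *. assert (Hi := labelling_ind E AE).
  rewrite <- (integ_ind m E), <- integ_const; auto; try apply Hm.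
  rewrite <- (Rmult_1_l (integ m (fun _ => eta))).
  rewrite <- integ_lin; auto using simple_const; [|apply Hm]. apply integ_le; auto.
  - exact (simple_comp (fun t => C * t + 1 * eta) _ Hi).
  - intros x. destruct (classic (E x)) as [Ex|Ex].
    + rewrite ind_1; auto. specialize (HC x). lra.
    + rewrite ind_0; auto. unfold E in Ex. lra.
Qed.

(** The humps are level sets of differences f_(n+p) - f_(n+q). They are large for a measure
    violating uniformity at stage n and, by Chebyshev, small for the finitely many measures already
    chosen, for each of which the sequence is Cauchy. *)
Lemma rel_weakly_compact_uniform_cauchy (M : ((Omega -> Prop) -> R) -> Prop) :
  (forall m, M m -> in_ba A m) -> rel_weakly_compact A M -> uniform_cauchy A M.
Proof.
  intros HM Hc M0 f HM0 Hf [C0 HC0] Hcau eps He. apply NNPP. intros Hno.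
  destruct (rel_weakly_compact_bounded M HM Hc) as [B0 HB0].
  set (B := Rmax B0 0). assert (HB : 0 <= B) by apply Rmax_r.
  set (C := Rmax C0 1). assert (HC : 0 < C) by (apply Rlt_le_trans with 1; [lra|apply Rmax_r]).
  (* Values below [eta] account for at most eps/2 of an integral above eps; since the difference is
     bounded by 2 C, the rest forces a level set of variation above [d]. *)
  set (eta := eps / (2 * (B + 1))). assert (Heta : 0 < eta) by (apply Rdiv_lt_0_compat; lra).
  assert (Eeta : eta * (B + 1) = eps / 2) by (unfold eta; field; lra).
  set (d := eps / (4 * C)). assert (Hd : 0 < d) by (apply Rdiv_lt_0_compat; lra).
  assert (Ed : 2 * C * d = eps / 2) by (unfold d; field; lra).
  assert (Hsg : forall a b, is_simple A (fun x => f a x - f b x))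
    by (intros a b; exact (simple_comp2 Rminus _ _ (Hf a) (Hf b))).
  assert (Hex : forall N, exists n mu p q, (N <= n)%nat /\ M0 mu /\
    eps < abs_integ A mu (fun x => f (n + p)%nat x - f (n + q)%nat x)).
  { intros N. apply NNPP. intros Hn. apply Hno. exists N. intros n HNn mu Hmu p q.
    apply Rnot_lt_le. intros Hlt. apply Hn. exists n, mu, p, q. auto. }
  destruct (dependent_choice_list (X := ((Omega -> Prop) -> R) * (Omega -> Prop))
    (fun w => M0 (fst w) /\ A (snd w) /\ d < tv A (fst w) (snd w))
    (fun l w => forall v, In v l -> tv A (fst v) (snd w) <= d / 8 * (/2) ^ (length l)))
    as [u Hu].
  - intros l Hl. set (dl := d / 8 * (/2) ^ (length l)).
    assert (Hdl : 0 < dl) by (apply Rmult_lt_0_compat; [lra|apply pow_lt; lra]).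
    destruct (finite_eventually (fun v n => forall p q,
      abs_integ A (fst v) (fun x => f (n + p)%nat x - f (n + q)%nat x) <= eta * dl) l) as [N HN].
    { intros v Hv. rewrite Forall_forall in Hl.
      destruct (Hcau (fst v) (proj1 (Hl v Hv)) (eta * dl)) as [N HN];
        [now apply Rmult_lt_0_compat|]. exists N. exact HN. }
    destruct (Hex N) as [n [mu [p [q [HNn [Hmu Hbig]]]]]].
    set (g := fun x => f (n + p)%nat x - f (n + q)%nat x) in *.
    assert (Hg : is_simple A g) by apply Hsg.
    exists (mu, fun x => Rabs (g x) > eta). simpl.
    assert (Hp : forall m, M0 m -> pos_add (tv A m)) by (intros; apply tv_pos_add; auto).
    split; [split; [auto|split]|].
    + apply (chebyshev _ g eta (Hp mu Hmu) Hg).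
    + assert (Hgb : forall x, Rabs (g x) <= 2 * C).
      { intros x. assert (B1 := HC0 (n + p)%nat x). assert (B2 := HC0 (n + q)%nat x).
        assert (C0 <= C) by apply Rmax_l. apply Rabs_le_inv in B1, B2.
        unfold g. apply Rabs_le. lra. }
      assert (H1 := integ_level_bound _ g eta _ (Hp mu Hmu) Hg (Rlt_le _ _ Heta) Hgb).
      unfold abs_integ in Hbig.
      assert (H2 : tv A mu setT <= B) by (eapply Rle_trans; [apply (HB0 mu); auto|apply Rmax_l]).
      assert (eta * tv A mu setT <= eta * B) by (apply Rmult_le_compat_l; lra).
      apply (Rmult_lt_reg_l (2 * C)); lra.
    + intros v Hv. rewrite Forall_forall in Hl.
      destruct (chebyshev _ g eta (Hp _ (proj1 (Hl v Hv))) Hg) as [_ H1].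
      assert (H2 := HN n HNn v Hv p q). unfold abs_integ in H2.
      apply (Rmult_le_reg_l eta); auto. unfold g in *. lra.
  - apply (rel_weakly_compact_no_hump M (fun n => fst (u n)) (fun n => snd (u n)) d); auto.
    + intros k. apply HM0, Hu.
    + intros k. apply Hu.
    + intros k. apply Hu.
    + intros i j Hij. destruct (Hu j) as [_ H]. rewrite length_map, length_seq in H.
      apply H. apply in_map_iff. exists i. split; auto. apply in_seq. lia.
Qed.
End Algebra.

(** * Equivalence of (i) and (ii), and the interchange of limits *)

Theorem mainTheorem7 (Omega : Type) (A : (Omega -> Prop) -> Prop)
  (hA : is_algebra A) (L : (nat -> R) -> R) (hL : banach_limit L)
  (M : ((Omega -> Prop) -> R) -> Prop) (hM : forall mu, M mu -> in_ba A mu) :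
  (rel_weakly_compact A M <-> (norm_bounded A M /\ uniform_cauchy A M)) /\
  (rel_weakly_compact A M ->
     norm_bounded A M /\
     forall (f : nat -> Omega -> R) (muk : nat -> (Omega -> Prop) -> R),
       (forall n, is_simple A (f n)) ->
       unif_bounded f ->
       (forall mu, M mu -> L1_cauchy A mu f) ->
       (forall k, M (muk k)) ->
       (exists a : nat -> R, forall k, Un_cv (fun n => integ (muk k) (f n)) (a k)) /\
       (forall a : nat -> R,
          (forall k, Un_cv (fun n => integ (muk k) (f n)) (a k)) ->
          Un_cv (fun n => L (fun k => integ (muk k) (f n))) (L a))).
Proof.
  assert (Hcomp : rel_weakly_compact A M -> norm_bounded A M /\ uniform_cauchy A M).
  { intros H. split; [now apply (rel_weakly_compact_bounded A hA L hL)|].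
    now apply (rel_weakly_compact_uniform_cauchy A hA L hL). }
  split.
  { split; auto. intros [H1 H2]. apply rel_weakly_compact_of_abs_cont; auto.
    now apply unif_cauchy_abs_cont. }
  intros Hc. destruct (Hcomp Hc) as [Hb Hu]. split; auto.
  intros f muk Hf [Cf HCf] Hcau Hmuk. destruct Hb as [B HB].
  (* The uniform Cauchy property, with M itself as the subset, gives a rate independent of k. *)
  assert (HUC : forall e, 0 < e -> exists N, forall n m k, (N <= n)%nat -> (N <= m)%nat ->
    Rabs (integ (muk k) (f n) - integ (muk k) (f m)) <= e).
  { intros e He. destruct (Hu M f) with (eps := e) as [N HN]; auto; [now exists Cf|].
    exists N. intros n m k Hn Hm. eapply Rle_trans; [apply (integ_dist A hA); auto|].
    assert (H := HN N (le_n _) (muk k) (Hmuk k) (n - N)%nat (m - N)%nat).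
    replace (N + (n - N))%nat with n in H by lia.
    replace (N + (m - N))%nat with m in H by lia. exact H. }
  (* [Cf] may be negative when Omega is empty. *)
  assert (Hbd : forall n k, Rabs (integ (muk k) (f n)) <= Rmax Cf 0 * B).
  { intros n k. eapply Rle_trans; [apply (integ_bound A hA _ _ (Rmax Cf 0)); auto|].
    - intros x. eapply Rle_trans; [apply HCf|apply Rmax_l].
    - apply Rmult_le_compat_l; [apply Rmax_r|auto]. }
  split.
  - assert (Hex : forall k, exists a, Un_cv (fun n => integ (muk k) (f n)) a).
    { intros k. assert (Hcr : Cauchy_crit (fun n => integ (muk k) (f n))).
      { intros e He. destruct (HUC (e / 2)) as [N HN]; [lra|]. exists N. intros n m Hn Hm.
        unfold Rdist. assert (H := HN n m k Hn Hm). lra. }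
      destruct (R_complete _ Hcr) as [a Ha]. now exists a. }
    exists (fun k => proj1_sig (constructive_indefinite_description _ (Hex k))).
    intros k. now destruct constructive_indefinite_description.
  - intros a Ha.
    (* Letting m tend to infinity in [HUC], the limits inherit the rate; this also bounds [a], so
       that [L a] is governed by the axioms of [L]. *)
    assert (Hnear : forall e, 0 < e -> exists N, forall n k, (N <= n)%nat ->
      Rabs (integ (muk k) (f n) - a k) <= e).
    { intros e He. destruct (HUC (e / 2)) as [N HN]; [lra|]. exists N. intros n k Hn.
      destruct (Ha k (e / 2)) as [N' HN']; [lra|].
      assert (H1 := HN n (N + N')%nat k Hn ltac:(lia)).
      assert (H2 := HN' (N + N')%nat ltac:(lia)). unfold Rdist in H2.
      apply Rabs_le_inv in H1. apply Rabs_def2 in H2. apply Rabs_le. lra. }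
    assert (Hba : bounded_seq a).
    { destruct (Hnear 1 Rlt_0_1) as [N HN]. exists (Rmax Cf 0 * B + 1). intros k.
      assert (H1 := HN N k (le_n _)). assert (H2 := Hbd N k).
      apply Rabs_le_inv in H1, H2. apply Rabs_le. lra. }
    intros e He. destruct (Hnear (e / 2)) as [N HN]; [lra|]. exists N. intros n Hn.
    assert (Hbn : bounded_seq (fun k => integ (muk k) (f n))) by (eexists; apply (Hbd n)).
    assert (Hbm := bounded_seq_lin 1 (-1) _ _ Hbn Hba).
    unfold Rdist. rewrite <- (blim_minus L hL); auto.
    apply Rle_lt_trans with (e / 2); [|lra]. apply (blim_abs_le L hL _ _ 0).
    + destruct Hbm as [C HC]. exists C. intros k. specialize (HC k). cbv beta in HC.
      replace (_ - _) with (1 * integ (muk k) (f n) + -1 * a k) by ring. exact HC.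
    + intros k _. now apply HN.
Qed.
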